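(* Let $G$ be a countably infinite discrete amenable group, let $X$ be a compact metrizable space, let $G \curvearrowright X$ be a free action by homeomorphisms, and let $M \in \mathbb{N}$. If the action has URPC (the Uniform Rokhlin Property and comparison) and $\mathrm{mdim}(G \curvearrowright X) < M/2$, then there exists a $G$-equivariant topological embedding of $X$ into $\left([0,1]^M\right)^G$, where $G$ acts on $\left([0,1]^M\right)^G$ by the left shift $(h\cdot y)_g = y_{h^{-1}g}$.
   Context: Invariance: for finite $K \subset G$ and $\varepsilon>0$, a finite set $S\subset G$ is $(K,\varepsilon)$-invariant if $\left|\bigcap_{g\in K} gS\right| > (1-\varepsilon)|S|$. Upper Banach density: for $A\subset X$ and nonempty finite $F\subset G$ put $\overline{D}_F(A)=\sup_{x\in X}\frac{|A\cap Fx|}{|F|}$, and $\overline{D}(A)=\inf_{F}\overline{D}_F(A)$ over all nonempty finite $F\subset G$. Castles: a tower is a pair $(S,V)$ with $S\subset G$ finite (the shape) and $V\subset X$ open (the base) such that the sets $gV$, $g\in S$, are pairwise disjoint. Write $SV=\bigcup_{g\in S}gV$. A castle is a finite collection of towers $\{(S_i,V_i)\}_{i=1}^n$ such that the sets $S_iV_i$ are pairwise disjoint. Uniform Rokhlin Property (URP): for every finite $K\subset G$ and every $\varepsilon>0$ there is a castle $\{(S_i,V_i)\}_{i=1}^n$ with $(K,\varepsilon)$-invariant shapes and $\overline{D}\left(X\setminus\bigsqcup_{i=1}^n S_iV_i\right)<\varepsilon$. Comparison: for $A\subset X$ closed and $B\subset X$ open write $A\prec B$ if there are finitely many open sets $U_j$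 covering $A$ and elements $g_j\in G$ such that the sets $g_jU_j$ are pairwise disjoint subsets of $B$. The action has comparison if $A\prec B$ whenever $A$ is closed, $B$ is open and $\mu(A)<\mu(B)$ for every $G$-invariant Borel probability measure $\mu$ on $X$. URPC means URP together with comparison. Mean dimension: for a collection $\mathcal{U}$ of open subsets of $X$, $\mathrm{ord}(\mathcal{U})=\sup_{x\in X}|\{U\in\mathcal{U}: x\in U\}|$. For an open cover $\mathcal{U}$, $\dim(\mathcal{U})=\inf_{\mathcal{V}}\mathrm{ord}(\mathcal{V})$ over all open covers $\mathcal{V}$ refining $\mathcal{U}$. The join $\bigvee_i\mathcal{U}_i$ of finitely many covers is the collection of all intersections $\bigcap_i U_i$ with $U_i\in\mathcal{U}_i$. For a real number $C\ge 0$, $\mathrm{mdim}(G\curvearrowright X)<C$ means: there is $\gamma>0$ such that for every open cover $\mathcal{U}$ of $X$ there are a finite set $F\subset G$ and $\varepsilon>0$ such that every $(F,\varepsilon)$-invariant finite set $S\subset G$ satisfies $\dim\left(\bigvee_{g\in S}g^{-1}\mathcal{U}\right)<(C-\gamma)|S|$. *)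

(* Defs.v *)
From HB Require Import structures.
From mathcomp Require Import all_boot all_order all_algebra finmap.
From mathcomp Require Import all_classical all_reals all_analysis.

Set Implicit Arguments.
Unset Strict Implicit.
Unset Printing Implicit Defensive.

Import Order.TTheory GRing.Theory Num.Theory.
Import numFieldNormedType.Exports.

Local Open Scope classical_set_scope.
Local Open Scope ring_scope.

(* [counting] takes the value +oo on infinite sets; in particular the
   intersection over K = fset0 is all of G and has cardinality #|G|, not 0. *)
Definition invariant_shape (R : realType) (G : groupType) (K : {fset G})
    (eps : R) (S : {fset G}) : Prop :=
  (((1 - eps) * #|` S|%:R)%:E <
   counting (\bigcap_(g in [set` K]) ((fun s => (g * s)%g) @` [set` S])))%E.

(* Amenability in Foelner form. *)
Definition amenable (R : realType) (G : groupType) : Prop :=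
  forall (K : {fset G}) (eps : R), 0 < eps ->
  exists S : {fset G}, S != fset0 /\ invariant_shape K eps S.

(* Continuity of every [act g] suffices for an action by homeomorphisms:
   the inverse of [act g] is [act g^-1]. *)
Definition continuous_action (G : groupType) (X : topologicalType)
    (act : G -> X -> X) : Prop :=
  [/\ forall x, act 1%g x = x,
      forall g h x, act (g * h)%g x = act g (act h x)
    & forall g, continuous (act g)].

Definition free_action (G : groupType) (X : Type) (act : G -> X -> X) : Prop :=
  forall g x, act g x = x -> g = 1%g.

Section density.
Context (R : realType) (G : groupType) (X : topologicalType).
Context (act : G -> X -> X).

(* Adjoining 0 makes the supremum one in [0, +oo]; it only matters when X is
   empty. *)
Definition density_along (F : {fset G}) (A : set X) : \bar R :=
  ereal_sup (0%E |`
    [set (counting (A `&` (act^~ x @` [set` F])) * (#|` F|%:R^-1)%:E)%E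
    | x in [set: X]]).

Definition upper_banach_density (A : set X) : \bar R :=
  ereal_inf [set density_along F A | F in [set F : {fset G} | F != fset0]].

End density.

Section castles.
Context (G : groupType) (X : topologicalType).
Context (act : G -> X -> X).

Definition tower_union (S : {fset G}) (V : set X) : set X :=
  \bigcup_(g in [set` S]) (act g @` V).

Definition is_tower (S : {fset G}) (V : set X) : Prop :=
  open V /\ trivIset [set` S] (fun g => act g @` V).

Definition is_castle (n : nat) (S : 'I_n -> {fset G}) (V : 'I_n -> set X) :
    Prop :=
  (forall i, is_tower (S i) (V i)) /\
  trivIset [set: 'I_n] (fun i => tower_union (S i) (V i)).

End castles.

Definition uniform_rokhlin (R : realType) (G : groupType)
    (X : topologicalType) (act : G -> X -> X) : Prop :=
  forall (K : {fset G}) (eps : R), 0 < eps ->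
  exists (n : nat) (S : 'I_n -> {fset G}) (V : 'I_n -> set X),
    [/\ is_castle act S V,
        forall i, invariant_shape K eps (S i)
      & (upper_banach_density R act
           (~` \bigcup_i tower_union act (S i) (V i)) < eps%:E)%E].

Definition subequivalent (G : groupType) (X : topologicalType)
    (act : G -> X -> X) (A B : set X) : Prop :=
  exists (n : nat) (U : 'I_n -> set X) (g : 'I_n -> G),
    [/\ forall j, open (U j),
        A `<=` \bigcup_j U j,
        forall j, act (g j) @` U j `<=` B
      & trivIset [set: 'I_n] (fun j => act (g j) @` U j)].

(* Measurable types of the library are pointed.  Carrying the point as a
   parameter gives the Borel space of X without assuming X nonempty; neither
   the sigma-algebra nor its measures depend on the point chosen. *)
Definition pointed_at (X : choiceType) (x0 : X) : Type := X.
HB.instance Definition _ (X : choiceType) (x0 : X) :=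
  Choice.on (pointed_at x0).
HB.instance Definition _ (X : choiceType) (x0 : X) :=
  isPointed.Build (pointed_at x0) x0.

Definition borel (X : topologicalType) (x0 : X) :=
  g_sigma_algebraType (@open X : set (set (pointed_at x0))).

Definition invariant_measure (R : realType) (G : groupType)
    (X : topologicalType) (act : G -> X -> X) (x0 : X)
    (mu : probability (borel x0) R) : Prop :=
  forall (g : G) (A : set (borel x0)), measurable A -> mu (act g @` A) = mu A.

Definition has_comparison (R : realType) (G : groupType) (X : topologicalType)
    (act : G -> X -> X) : Prop :=
  forall A B : set X, closed A -> open B ->
  (forall (x0 : X) (mu : probability (borel x0) R),
     invariant_measure act mu -> (mu A < mu B)%E) ->
  subequivalent act A B.

Definition URPC (R : realType) (G : groupType) (X : topologicalType)
    (act : G -> X -> X) : Prop :=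
  uniform_rokhlin R act /\ has_comparison R act.

Definition open_cover (X : topologicalType) (U : set (set X)) : Prop :=
  U `<=` open /\ \bigcup_(A in U) A = [set: X].

Definition refines (X : Type) (V U : set (set X)) : Prop :=
  forall B, V B -> exists2 A, U A & B `<=` A.

(* As in [density_along], 0 is adjoined for the empty space. *)
Definition cover_ord (R : realType) (X : Type) (U : set (set X)) : \bar R :=
  ereal_sup (0%E |` [set counting [set A | U A /\ A x] | x in [set: X]]).

Definition cover_dim (R : realType) (X : topologicalType) (U : set (set X)) :
    \bar R :=
  ereal_inf [set cover_ord R V | V in [set V | open_cover V /\ refines V U]].

(* [join_covers S U] is the join of the covers [U g], g in S. *)
Definition join_covers (I : choiceType) (X : Type) (S : {fset I})
    (U : I -> set (set X)) : set (set X) :=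
  [set W | exists A : I -> set X,
     (forall g, g \in S -> U g (A g)) /\ W = \bigcap_(g in [set` S]) A g].

Definition translate_cover (G : groupType) (X : Type) (act : G -> X -> X)
    (g : G) (U : set (set X)) : set (set X) :=
  [set act g @` A | A in U].

Definition mdim_lt (R : realType) (G : groupType) (X : topologicalType)
    (act : G -> X -> X) (C : R) : Prop :=
  exists2 gamma : R, 0 < gamma &
  forall U : set (set X), open_cover U ->
  exists (F : {fset G}) (eps : R), 0 < eps /\
  forall S : {fset G}, invariant_shape F eps S ->
    (cover_dim R (join_covers S (fun g => translate_cover act g^-1%g U)) <
     ((C - gamma) * #|` S|%:R)%:E)%E.

(* ([0,1]^M)^G, with the product topology. *)
Definition cube_shift (R : realType) (M : nat) (G : groupType) :
    topologicalType :=
  {ptws G -> {ptws 'I_M -> set_type (`[0, 1]%classic : set R)}}.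

Definition left_shift (R : realType) (M : nat) (G : groupType) (h : G)
    (y : cube_shift R M G) : cube_shift R M G :=
  fun g => y (h^-1 * g)%g.

(* A homeomorphism onto the image, the latter with the subspace topology. *)
Definition topological_embedding (X Y : topologicalType) (f : X -> Y) : Prop :=
  [/\ injective f, continuous f
    & forall A : set X, open A ->
        open ((f @` A) : set (subspace (range f)))].

(* Main.v *)
(* An equivariant map X -> ([0,1]^M)^G is x |-> (f (g^-1 x))_g for a continuous
   f : X -> [0,1]^M, and it is injective iff no two points x, y satisfy
   f (g x) = f (g y) for all g.  Such an f is a limit of maps separating points
   at distance >= eps, for smaller and smaller eps.

   - Comparison places markers for the bases of a sequence of castles C_n
     inside one open set {beta > 1/2} of small density, on which coordinate 0 of
     f is frozen once and for all; so f always determines, approximately, in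
     which level of C_n every point of an orbit lies.
   - A map fr (f off the frozen set) is perturbed tower by tower.  On a tower of
     shape S, the values at s v, s in S, are replaced by an affine function of the
     position of v in the nerve of a cover of order < (M/2 - gamma)|S|, in
     general position; since 2 (M/2 - gamma)|S| < M |S|, this is injective on the
     nerve even when the few coordinates in frozen positions are ignored, and
     gamma |S| real parameters remain free.
   - The remainder Z of the castle has tiny density.  Finitely many real
     functions separate points at distance >= eps, and comparison moves Z into
     the towers, where the free parameters record their values. *)
Require Import Defs.
From HB Require Import structures.
From mathcomp Require Import all_boot all_order all_algebra finmap.
From mathcomp Require Import all_classical all_reals all_analysis.
From mathcomp Require Import measurable_realfun.
From mathcomp Require Import lra.

Set Implicit Arguments.
Unset Strict Implicit.
Unset Printing Implicit Defensive.

Import Order.TTheory GRing.Theory Num.Theory.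
Import numFieldNormedType.Exports.

Local Open Scope classical_set_scope.
Local Open Scope ring_scope.

(** The code on a tower makes sense only to a reader who knows where the tower sits, and later
    perturbations would blur any marker written by an earlier one. This is possible because two real
    functions suffice to code a countable disjoint family. Three frozen slots result: one whose
    value above 1/2 announces the marker, and two for the components of [H]. The unfrozen values
    stay at most 1/2, so that they cannot imitate the announcement.

    Cutoff functions replace sharp towers, with a gap between thresholds: a level is used above 3/4,
    decoding guarantees 1/2 for the partner point, and the pasted codes are exact from 1/2 on.

    The budget on a tower of shape S: each of two points loses at most gamma |S| / (2M) positions to
    the slots, that is gamma |S| of the M |S| coordinates for the pair; the two simplices of the
    nerve take at most M |S| - 2 gamma |S|; the remaining gamma |S| coordinates pay for the free
    parameters. *)

(** * Continuous real-valued functions and finite subcovers *)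

Lemma contD (R : realType) (T : topologicalType) (f g : T -> R) :
  continuous f -> continuous g -> continuous (fun x => f x + g x).
Proof. by move=> cf cg x; apply: cvgD; [exact: cf|exact: cg]. Qed.

Lemma contM (R : realType) (T : topologicalType) (f g : T -> R) :
  continuous f -> continuous g -> continuous (fun x => f x * g x).
Proof. by move=> cf cg x; apply: cvgM; [exact: cf|exact: cg]. Qed.

Lemma contC (R : realType) (T : topologicalType) (a : R) :
  continuous (fun _ : T => a).
Proof. by move=> x; exact: cvg_cst. Qed.

Lemma contN (R : realType) (T : topologicalType) (f : T -> R) :
  continuous f -> continuous (fun x => - f x).
Proof. by move=> cf x; apply: cvgN; exact: cf. Qed.

Lemma contB (R : realType) (T : topologicalType) (f g : T -> R) :
  continuous f -> continuous g -> continuous (fun x => f x - g x).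
Proof. by move=> cf cg; apply: contD => //; exact: contN. Qed.

Lemma cont_comp (S T U : topologicalType) (f : S -> T) (g : T -> U) :
  continuous f -> continuous g -> continuous (fun x => g (f x)).
Proof.
by move=> cf cg x; apply: (@continuous_comp _ _ _ f g) => //; [exact: cf|exact: cg].
Qed.

Lemma contV (R : realType) (T : topologicalType) (f : T -> R) :
  continuous f -> (forall x, f x != 0) -> continuous (fun x => (f x)^-1).
Proof. by move=> cf f0 x; apply: cvgV => //; exact: cf. Qed.

Lemma cont_norm (R : realType) (T : topologicalType) (f : T -> R) :
  continuous f -> continuous (fun x => `|f x|).
Proof. by move=> cf x; apply: cvg_norm; exact: cf. Qed.

Lemma cont_max (R : realType) (T : topologicalType) (f g : T -> R) :
  continuous f -> continuous g -> continuous (fun x => Num.max (f x) (g x)).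
Proof.
move=> cf cg.
have -> : (fun x => Num.max (f x) (g x)) =
          (fun x => (f x + g x + `|f x - g x|) / 2).
  by apply/funext => x; rewrite maxr_absE.
apply: contM; last exact: contC.
by apply: contD; [exact: contD|apply: cont_norm; exact: contB].
Qed.

Lemma cont_min (R : realType) (T : topologicalType) (f g : T -> R) :
  continuous f -> continuous g -> continuous (fun x => Num.min (f x) (g x)).
Proof.
move=> cf cg.
have -> : (fun x => Num.min (f x) (g x)) =
          (fun x => - Num.max (- f x) (- g x)).
  by apply/funext => x; rewrite oppr_max !opprK.
by apply: contN; apply: cont_max; exact: contN.
Qed.

Lemma cont_sum (R : realType) (T : topologicalType) (I : Type) (s : seq I)
    (P : pred I) (f : I -> T -> R) :
  (forall i, P i -> continuous (f i)) ->
  continuous (fun x => \sum_(i <- s | P i) f i x).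
Proof.
move=> cf; elim: s => [|i s IH].
  have -> : (fun x => \sum_(i <- [::] | P i) f i x) = (fun=> 0).
    by apply/funext => x; rewrite big_nil.
  exact: contC.
have -> : (fun x => \sum_(i <- i :: s | P i) f i x) =
   (fun x => (if P i then f i x else 0) + \sum_(i <- s | P i) f i x).
  by apply/funext => x; rewrite big_cons; case: (P i); rewrite ?add0r.
apply: contD IH; case Pi: (P i); [exact: cf|exact: contC].
Qed.

Lemma continuousP_dist (R : realType) (T : topologicalType) (f : T -> R) :
  continuous f <->
  forall x e, 0 < e -> \forall y \near x, `|f x - f y| < e.
Proof.
split=> [cf x e e0|H x]; last by apply/cvgrPdist_lt => e e0; exact: H.
by have /cvgrPdist_lt := cf x; exact.
Qed.

Lemma open_gt_cont (R : realType) (T : topologicalType) (f : T -> R) (a : R) :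
  continuous f -> open [set x | a < f x].
Proof.
move=> cf; apply: (@open_comp _ _ f [set y | a < y]); last exact: open_gt.
by move=> x _; exact: cf.
Qed.

Lemma open_lt_cont (R : realType) (T : topologicalType) (f : T -> R) (a : R) :
  continuous f -> open [set x | f x < a].
Proof.
move=> cf; apply: (@open_comp _ _ f [set y | y < a]); last exact: open_lt.
by move=> x _; exact: cf.
Qed.

Lemma closed_ge_cont (R : realType) (T : topologicalType) (f : T -> R) (a : R) :
  continuous f -> closed [set x | a <= f x].
Proof.
move=> cf; apply: (@preimage_closed _ _ f [set y | a <= y]); last exact: closed_ge.
by move=> x _; exact: cf.
Qed.

Lemma closed_le_cont (R : realType) (T : topologicalType) (f : T -> R) (a : R) :
  continuous f -> closed [set x | f x <= a].
Proof.
move=> cf; apply: (@preimage_closed _ _ f [set y | y <= a]); last exact: closed_le.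
by move=> x _; exact: cf.
Qed.

(** Compactness is used in its near-covering form, along the filter of finite lists ordered by
    inclusion: once a list contains [i], all points of [f i] are covered. *)
Lemma finite_subcover (T : topologicalType) (A : set T) (I : choiceType)
    (f : I -> set T) :
  compact A -> (forall i, open (f i)) -> A `<=` \bigcup_i f i ->
  exists s : seq I, uniq s /\ forall x, A x -> exists2 i, i \in s & f i x.
Proof.
move=> /compact_near_coveringP cA fo Af.
pose F : set_system (seq I) :=
  filter_from setT (fun s : seq I => [set s' | {subset s <= s'}]).
have FF : Filter F.
  apply: filter_from_filter; first by exists [::].
  move=> s1 s2 _ _; exists (s1 ++ s2) => // s' H; split => z zs; apply: H;
    by rewrite mem_cat zs ?orbT.
have := cA _ F (fun s x => exists2 i, i \in s & f i x) FF.
case.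
  move=> x Ax; have [i _ fix_] := Af _ Ax.
  exists (f i, [set s | {subset [:: i] <= s}]) => /=; last first.
    by move=> [y s] /= [fy H]; exists i => //; apply: H; rewrite inE.
  by split; [exact: open_nbhs_nbhs|exists [:: i]].
move=> s _ /= /(_ (undup s)) H; exists (undup s); split; first exact: undup_uniq.
by apply: H => z; rewrite mem_undup.
Qed.

(** * Cutoff functions and uniform limits on metric spaces *)

Section metric.
Context (R : realType) (X : metricType R).

Lemma nbhs_mdist (x : X) (P : set X) : nbhs x P <->
  exists2 e : R, 0 < e & forall y, mdist x y < e -> P y.
Proof.
split=> [/nbhs_ballP[e e0 H]|[e e0 H]].
  by exists e => // y xy; apply: H; rewrite ballEmdist.
by apply/nbhs_ballP; exists e => // y; rewrite ballEmdist; exact: H.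
Qed.

Lemma lipschitz_cont (u : X -> R) :
  (forall x y, u x <= u y + mdist x y) -> continuous u.
Proof.
move=> H; apply/continuousP_dist => x e e0; apply/nbhs_mdist; exists e => // y xy.
rewrite ltr_norml; have := H x y; have := H y x; rewrite (metric_sym y x).
by move=> h1 h2; apply/andP; split; lra.
Qed.

(** The function is the distance to the complement, truncated at 1. Putting 1 into the set whose
    infimum is taken gives the truncation and covers the case of an empty complement. *)
Lemma cozero (O : set X) : open O ->
  exists u : X -> R, [/\ continuous u, forall x, 0 <= u x <= 1
    & forall x, (0 < u x) <-> O x].
Proof.
move=> oO; pose D x := [set (1 : R)] `|` [set mdist x a | a in ~` O].
have D0 x : D x !=set0 by exists 1; left.
have Dlb x : lbound (D x) 0.
  by move=> _ [->|[a _ <-]]; [exact: ler01|exact: mdist_ge0].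
have Dhl x : has_lbound (D x) by exists 0.
exists (fun x => inf (D x)); split.
- apply: lipschitz_cont => x y; rewrite -lerBlDr.
  apply: lb_le_inf => // _ [->|[a Oa <-]]; rewrite lerBlDr.
    by apply: (@le_trans _ _ 1); [apply: ge_inf => //; left|rewrite lerDl mdist_ge0].
  apply: (@le_trans _ _ (mdist x a)); first by apply: ge_inf => //; right; exists a.
  by rewrite addrC; exact: metric_triangle.
- move=> x; rewrite lb_le_inf//=; apply: ge_inf => //; by left.
- move=> x; split=> [D_gt0|Ox].
    apply: contrapT => nOx; move: D_gt0; rewrite ltNge => /negP; apply.
    by apply: ge_inf => //; right; exists x => //; exact: mdistxx.
  have /nbhs_mdist[e e0 eO] : nbhs x O by exact: open_nbhs_nbhs.
  apply: (@lt_le_trans _ _ (Num.min 1 e)); first by rewrite lt_min ltr01.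
  apply: lb_le_inf => // _ [->|[a nOa <-]]; rewrite ge_min ?lexx//.
  by apply/orP; right; rewrite leNgt; apply/negP => /eO.
Qed.

(** Take a / (a + b) with a positive exactly on [O] and b positive exactly off [A]; since [A] lies
    in [O], the denominator never vanishes. *)
Lemma urysohn_fun (A O : set X) : closed A -> open O -> A `<=` O ->
  exists u : X -> R, [/\ continuous u, forall x, 0 <= u x <= 1,
    forall x, A x -> u x = 1 & forall x, 0 < u x -> O x].
Proof.
move=> cA oO AO.
have [a [ca a01 aP]] := cozero oO.
have [b [cb b01 bP]] := cozero (closed_openC cA).
have ab x : 0 < a x + b x.
  have [/AO Ox|nAx] := pselect (A x).
    by apply: ltr_pwDl; [exact/aP|have /andP[] := b01 x].
  by apply: ltr_wpDl; [have /andP[] := a01 x|exact/bP].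
exists (fun x => a x / (a x + b x)); split.
- apply: contM => //; apply: contV; first exact: contD.
  by move=> x; rewrite gt_eqF.
- move=> x; have /andP[a0 _] := a01 x; have /andP[b0 _] := b01 x.
  by rewrite divr_ge0 ?(ltW (ab x))//= ler_pdivrMr// mul1r lerDl.
- move=> x Ax; have -> : b x = 0.
    apply/eqP; rewrite eq_le; have /andP[-> _] := b01 x; rewrite andbT leNgt.
    by apply/negP => /bP.
  by rewrite addr0 divff// gt_eqF//; apply/aP; exact: AO.
- by move=> x; rewrite pmulr_lgt0 ?invr_gt0// => /aP.
Qed.

(** The intervals of radius [e n] = 2 * 2^-n around [u n x], with [e n] the tail of the geometric
    series, are nested. The supremum of their left ends is the limit and comes with the rate of
    convergence. *)
Lemma uniform_limit (u : nat -> X -> R) :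
  (forall n, continuous (u n)) ->
  (forall n x, `|u n.+1 x - u n x| <= 2^-1 ^+ n) ->
  exists v : X -> R, continuous v /\
    forall n x, `|v x - u n x| <= 2 * 2^-1 ^+ n.
Proof.
move=> cu du; pose e n : R := 2 * 2^-1 ^+ n.
have eS n : e n = 2^-1 ^+ n + e n.+1 by rewrite /e exprS; lra.
have lo n x : u n x - e n <= u n.+1 x - e n.+1.
  by have := du n x; rewrite ler_norml => /andP[h _]; have := eS n; lra.
have hi n x : u n.+1 x + e n.+1 <= u n x + e n.
  by have := du n x; rewrite ler_norml => /andP[_ h]; have := eS n; lra.
have e0 n : 0 <= e n by rewrite /e mulr_ge0// exprn_ge0.
have lom n m x : (n <= m)%N -> u n x - e n <= u m x - e m.
  elim: m => [|m IH]; first by rewrite leqn0 => /eqP->.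
  by rewrite leq_eqVlt => /predU1P[->//|/IH] /le_trans; apply.
have him n m x : (n <= m)%N -> u m x + e m <= u n x + e n.
  elim: m => [|m IH]; first by rewrite leqn0 => /eqP->.
  by rewrite leq_eqVlt => /predU1P[->//|/IH]; apply: le_trans.
have lohi n m x : u n x - e n <= u m x + e m.
  have [nm|/ltnW mn] := leqP n m.
    by have := lom _ _ x nm; have := e0 m; lra.
  by have := him _ _ x mn; have := e0 n; lra.
pose E x := [set u n x - e n | n in [set: nat]].
have E0 x : E x !=set0 by exists (u 0%N x - e 0%N), 0%N.
have Eub m x : ubound (E x) (u m x + e m) by move=> _ [n _ <-]; exact: lohi.
pose v x := sup (E x).
have vP n x : `|v x - u n x| <= e n.
  have h1 : v x <= u n x + e n by exact: (ge_sup (E0 x) (Eub n x)).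
  have h2 : u n x - e n <= v x.
    have hE : has_ubound (E x) by exists (u 0%N x + e 0%N); exact: Eub.
    by apply: (ub_le_sup hE); exists n.
  by rewrite ler_norml; apply/andP; split; lra.
exists v; split=> //; apply/continuousP_dist => x d d0.
have [n nd] : exists n, e n < d / 3.
  have := @cvg_geometric R 2 2^-1; rewrite ger0_norm ?invr_ge0//.
  rewrite invf_lt1 ?ltr1n// => /(_ isT) /cvgrPdist_lt/(_ (d / 3)).
  case; first by rewrite divr_gt0.
  move=> n _ /(_ n (leqnn n)) /=; rewrite sub0r normrN ger0_norm.
    by exists n.
  exact: (e0 n).
have := (continuousP_dist (u n)).1 (cu n) x (d / 3).
have d3 : 0 < d / 3 by rewrite divr_gt0.
move=> /(_ d3); apply: filterS => y.
have := vP n x; have := vP n y.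
rewrite ltr_norml ler_norml ler_norml ltr_norml.
by move=> /andP[? ?] /andP[? ?] /andP[? ?]; apply/andP; split; lra.
Qed.

End metric.

(** * Invariant measures *)

Section action.
Context (R : realType) (G : groupType) (X : metricType R) (act : G -> X -> X).
Hypothesis act_action : continuous_action act.

Lemma act1 x : act 1%g x = x. Proof. by case: act_action. Qed.

Lemma actM g h x : act (g * h)%g x = act g (act h x).
Proof. by case: act_action. Qed.

Lemma act_cont g : continuous (act g). Proof. by case: act_action. Qed.

Lemma actK g x : act g^-1%g (act g x) = x.
Proof. by rewrite -actM mulVg act1. Qed.

Lemma actKV g x : act g (act g^-1%g x) = x.
Proof. by rewrite -actM mulgV act1. Qed.

Lemma act_image g (A : set X) : act g @` A = act g^-1%g @^-1` A.
Proof.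
apply/seteqP; split=> [_ [x Ax <-]|x Ax] /=; first by rewrite actK.
by exists (act g^-1%g x) => //; rewrite actKV.
Qed.

Lemma act_preimage_open g (A : set X) : open A -> open (act g @^-1` A).
Proof. by move=> oA; apply: open_comp => // x _; exact: act_cont. Qed.

Lemma cont_act g (f : X -> R) : continuous f -> continuous (fun x => f (act g x)).
Proof. by move=> cf; apply: (cont_comp (@act_cont g) cf). Qed.

Section invariant.
Context (x0 : X) (mu : probability (borel x0) R).
Hypothesis mu_inv : invariant_measure act mu.

Let B := borel x0.

Lemma measurable_open (A : set X) : open A -> measurable (A : set B).
Proof. by move=> oA; exact: sub_sigma_algebra. Qed.

Lemma measurable_closed (A : set X) : closed A -> measurable (A : set B).
Proof.
move=> cA; rewrite -[A]setCK; apply: measurableC.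
by apply: measurable_open; exact: closed_openC.
Qed.

Lemma measurable_act g (A : set X) :
  measurable (A : set B) -> measurable (act g @^-1` A : set B).
Proof.
move=> mA; have mf : measurable_fun setT (act g : B -> B).
  apply: (@measurability _ _ B B setT (act g) (@open X)) => //.
  move=> _ [C oC <-]; apply: measurable_open.
  by rewrite setTI; exact: act_preimage_open.
by have := mf measurableT _ mA; rewrite setTI.
Qed.

Definition mass (A : set X) : R := fine (mu (A : set B)).

Lemma massE (A : set X) : measurable (A : set B) -> mu (A : set B) = (mass A)%:E.
Proof. by move=> mA; rewrite /mass fineK//; exact: fin_num_measure. Qed.

Lemma mass_act g (A : set X) : measurable (A : set B) ->
  mu (act g @^-1` A : set B) = (mass A)%:E.
Proof.
move=> mA; rewrite -massE// -(mu_inv g^-1%g mA); congr (mu _).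
by rewrite act_image invgK.
Qed.

Lemma integral_indic_sum (I : Type) (r : seq I) (a : I -> R) (g : I -> G)
    (A : I -> set X) :
  (forall i, 0 <= a i) -> (forall i, measurable (A i : set B)) ->
  (\int[mu]_x (\sum_(i <- r) a i * \1_(A i) (act (g i) x))%:E =
   (\sum_(i <- r) a i * mass (A i))%:E)%E.
Proof.
move=> a0 mA.
have mI i : measurable_fun [set: B]
    ((fun x => (\1_(act (g i) @^-1` A i) x)%:E) : B -> \bar R).
  apply/measurable_EFinP; apply: measurable_indic; exact: measurable_act.
transitivity (\int[mu]_x (\sum_(i <- r)
    ((a i)%:E * (\1_(act (g i) @^-1` A i) x)%:E)))%E.
  by apply: eq_integral => x _; rewrite sumEFin.
rewrite ge0_integral_sum//; last 2 first.
- by move=> i; apply: measurable_funeM.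
- by move=> i x _; rewrite mule_ge0// lee_fin.
rewrite -sumEFin; apply: eq_bigr => i _.
rewrite ge0_integralZl_EFin//.
rewrite integral_indic//; last exact: measurable_act.
by rewrite setIT EFinM; congr (_ * _)%E; exact: mass_act.
Qed.

(** Integrating a pointwise inequality between sums of translated indicators removes the
    translations, by invariance, and fixes [c], since [mu] has total mass 1. All estimates of masses
    below are pointwise counts along orbits fed into this lemma. *)
Lemma mass_transfer (I J : Type) (r : seq I) (s : seq J) (a : I -> R)
    (b : J -> R) (g : I -> G) (h : J -> G) (A : I -> set X) (C : J -> set X)
    (c : R) :
  (forall i, 0 <= a i) -> (forall j, 0 <= b j) -> 0 <= c ->
  (forall i, measurable (A i : set B)) -> (forall j, measurable (C j : set B)) ->
  (forall x, \sum_(i <- r) a i * \1_(A i) (act (g i) x) <=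
     c + \sum_(j <- s) b j * \1_(C j) (act (h j) x)) ->
  \sum_(i <- r) a i * mass (A i) <= c + \sum_(j <- s) b j * mass (C j).
Proof.
move=> a0 b0 c0 mA mC H; rewrite -lee_fin EFinD.
rewrite -(integral_indic_sum r g a0 mA) -(integral_indic_sum s h b0 mC).
have mS (K : Type) (t : seq K) (d : K -> R) (k : K -> G) (D : K -> set X) :
    (forall i, measurable (D i : set B)) ->
    measurable_fun [set: B]
      ((fun x => (\sum_(i <- t) d i * \1_(D i) (act (k i) x))%:E) : B -> \bar R).
  move=> mD; apply/measurable_EFinP; apply: measurable_sum => i.
  apply: measurable_funM => //.
  rewrite (_ : (fun x => _) = \1_(act (k i) @^-1` D i))//.
  by apply: measurable_indic; exact: measurable_act.
have -> : (c%:E = \int[mu]_x (cst c%:E x))%E.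
  rewrite integral_cst// -[LHS]mule1; congr (_ * _)%E.
  exact: (esym (probability_setT mu)).
have s0 (K : Type) (t : seq K) (d : K -> R) (k : K -> G) (D : K -> set X) x :
    (forall i, 0 <= d i) -> 0 <= \sum_(i <- t) d i * \1_(D i) (act (k i) x).
  by move=> d0; apply: sumr_ge0 => i _; rewrite mulr_ge0.
rewrite -ge0_integralD//; last 2 first.
- by move=> x _; rewrite lee_fin s0.
- exact: mS.
apply: ge0_le_integral => //.
- by move=> x _; rewrite lee_fin s0.
- exact: mS.
- by apply: emeasurable_funD => //; exact: mS.
- by move=> x _; rewrite /= -EFinD lee_fin.
Qed.

End invariant.

Definition mass_ge (c : R) (A : set X) : Prop :=
  forall (x0 : X) (mu : probability (borel x0) R),
    invariant_measure act mu -> c <= mass mu A.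

Definition mass_le (c : R) (A : set X) : Prop :=
  forall (x0 : X) (mu : probability (borel x0) R),
    invariant_measure act mu -> mass mu A <= c.

(** Comparison in the form used below: a numerical gap valid for all invariant measures is the
    input, and the output is stated on points, disjointness being injectivity of the piecewise
    translation. *)
Lemma comparison_mass (A D : set X) (a d : R) :
  has_comparison R act -> closed A -> open D ->
  mass_le a A -> mass_ge d D -> a < d ->
  exists (n : nat) (U : 'I_n -> set X) (g : 'I_n -> G),
    [/\ forall j, open (U j), forall x, A x -> exists j, U j x,
        forall j x, U j x -> D (act (g j) x)
      & forall i j x y, U i x -> U j y -> act (g i) x = act (g j) y ->
          i = j /\ x = y].
Proof.
move=> cmp cA oD lA gD ad.
have [x0 mu mu_inv|n [U [g [oU AU UD tU]]]] := cmp A D cA oD.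
  rewrite (massE mu (measurable_closed (x0:=x0) cA)).
  rewrite (massE mu (measurable_open (x0:=x0) oD)).
  by rewrite lte_fin; apply: le_lt_trans (lA _ _ mu_inv) (lt_le_trans ad (gD _ _ mu_inv)).
exists n, U, g; split => //.
- by move=> x /AU[j _ Ujx]; exists j.
- by move=> j x Ujx; apply: (UD j); exists x.
- move=> i j x y Uix Ujy e.
  have ij : i = j.
    apply: (tU i j) => //; exists (act (g i) x); split; first by exists x.
    by rewrite e; exists y.
  by subst j; split => //; rewrite -(actK (g i) x) e actK.
Qed.

End action.

(** * Vectors in general position *)

(** If the value found for the tail of the list is the one forbidden by [k], a second search below
    half of it cannot hit that value again. *)
Lemma avoid_points (R : realFieldType) (K : eqType) (l : seq K) (B : K -> R -> Prop) (r : R) :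
  (forall k t1 t2, k \in l -> B k t1 -> B k t2 -> t1 = t2) ->
  0 < r -> exists t, [/\ 0 < t, t <= r & forall k, k \in l -> ~ B k t].
Proof.
elim: l r => [|k l IH] r uB r0; first by exists r.
have uB' k' t1 t2 : k' \in l -> B k' t1 -> B k' t2 -> t1 = t2.
  by move=> kl; apply: uB; rewrite inE kl orbT.
have [t1 [t10 t1r B1]] := IH r uB' r0.
case: (pselect (B k t1)) => [Bkt1|nB]; last first.
  by exists t1; split => // k'; rewrite inE => /predU1P[->|/B1].
have [|t2 [t20 t2r B2]] := IH (t1 / 2) uB'; first by rewrite divr_gt0.
exists t2; split => //; first by lra.
move=> k'; rewrite inE => /predU1P[->|/B2//] /(uB k _ _ (mem_head _ _) Bkt1).
by lra.
Qed.

Section general_position.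
Context (R : realFieldType) (N : finType).

Definition subspace_pred (W : (N -> R) -> Prop) :=
  forall x y v w, W v -> W w -> W (fun s => x * v s + y * w s).

(** Induction on the list. If the vector [v0] found for the tail lies in [W k], it is moved along a
    direction [e] outside [W k]: every nonzero displacement leaves [W k], and each of the other
    subspaces is met for at most one parameter. *)
Lemma avoid_subspaces (K : eqType) (l : seq K) (W : K -> (N -> R) -> Prop)
    (b : N -> R) (d : R) :
  (forall k v w, v =1 w -> W k v -> W k w) ->
  (forall k, k \in l -> subspace_pred (W k) /\ exists e, ~ W k e) -> 0 < d ->
  exists v, (forall s, `|v s - b s| <= d) /\ forall k, k \in l -> ~ W k v.
Proof.
move=> extW; elim: l d => [|k l IH] d sW d0.
  by exists b; split => // s; rewrite subrr normr0 ltW.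
have sW' k' : k' \in l -> subspace_pred (W k') /\ exists e, ~ W k' e.
  by move=> kl; apply: sW; rewrite inE kl orbT.
have [|v0 [v0b v0W]] := IH (d / 2) sW'; first by rewrite divr_gt0.
have [lk [e We]] := sW k (mem_head _ _).
case: (pselect (W k v0)) => [Wv0|nW]; last first.
  exists v0; split=> [s|k']; first by have := v0b s; lra.
  by rewrite inE => /predU1P[->|/v0W].
pose m := 1 + \sum_s `|e s|.
have m0 : 0 < m by rewrite ltr_pwDl// sumr_ge0.
have em_ s : `|e s| <= m.
  rewrite /m (bigD1 s)//= addrCA lerDl addr_ge0// sumr_ge0//.
have [||t [t0 tr tB]] := @avoid_points R K l
    (fun k' t => W k' (fun s => v0 s + t * e s)) (d / 2 / m).
- move=> k' t1 t2 k'l W1 W2; apply/eqP; apply/negPn/negP => t12.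
  apply: (v0W _ k'l); have t120 : t1 - t2 != 0 by rewrite subr_eq0.
  have [sk' _] := sW' _ k'l.
  (* This combination of v0 + t1 e and v0 + t2 e is [v0] itself, which was chosen outside [W k']. *)
  have := sk' (- t2 / (t1 - t2)) (t1 / (t1 - t2)) _ _ W1 W2.
  apply: extW => s; have : (t1 - t2)^-1 * (t1 - t2) * v0 s = v0 s.
    by rewrite mulVf// mul1r.
  by lra.
- by rewrite divr_gt0// divr_gt0.
exists (fun s => v0 s + t * e s); split.
  move=> s; have := v0b s; have : `|t * e s| <= d / 2.
    rewrite normrM gtr0_norm//; apply: (@le_trans _ _ (t * m)).
      by rewrite ler_pM2l.
    by rewrite -ler_pdivlMr.
  rewrite !ler_norml => /andP[? ?] /andP[? ?]; apply/andP; split; lra.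
move=> k'; rewrite inE => /predU1P[->|/tB//] Wt; apply: We.
have := lk t^-1 (- t^-1) _ _ Wt Wv0; apply: extW => s.
have : t^-1 * t * e s = e s by rewrite mulVf ?mul1r// gt_eqF.
by lra.
Qed.

(** Fewer than |T| rows have rank below |T|, so some row of the identity matrix is outside their
    span; [e] is that unit vector, extended by 0 outside [T]. *)
Lemma span_proper (I : finType) (a : I -> N -> R) (J : {set I}) (T : {set N}) :
  (#|J| < #|T|)%N -> exists e : N -> R, forall c : I -> R,
    (forall i, i \notin J -> c i = 0) ->
    ~ (forall s, s \in T -> e s = \sum_i c i * a i s).
Proof.
move=> JT; pose A : 'M[R]_(#|J|, #|T|) :=
  \matrix_(j, t) a (enum_val j) (enum_val t).
have : ~~ row_full A.
  rewrite /row_full neq_ltn; apply/orP; left.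
  exact: leq_ltn_trans (rank_leq_row A) JT.
rewrite -sub1mx => /row_subPn[t nt]; pose v := row t (1%:M : 'M[R]_#|T|).
exists (fun s => \sum_(t' < #|T|) (if enum_val t' == s then v 0 t' else 0)).
move=> c cJ H; move/negP: nt; apply.
apply/submxP; exists (\row_j c (enum_val j)).
apply/rowP => t'; have := H _ (enum_valP t').
rewrite (bigD1 t')//= eqxx big1 ?addr0; last first.
  by move=> t'' /negPf; rewrite (inj_eq enum_val_inj) => ->.
move=> ->; rewrite mxE (bigID (mem J))/= [X in _ + X]big1 ?addr0; last first.
  by move=> i /cJ ->; rewrite mul0r.
rewrite (big_enum_val (fun i => c i * a i (enum_val t'))).
by apply: eq_bigr => j _; rewrite !mxE.
Qed.

(** The vectors are chosen one after the other, each avoiding the finitely many subspaces of vectors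
    whose restriction to some [T] is spanned by a family of fewer than |T| of the others. The list
    in the induction records the indices already treated, and [c] is required to vanish outside
    it. *)
Lemma general_position (I : finType) (b : I -> N -> R) (d : R) : 0 < d ->
  exists a : I -> N -> R, (forall i s, `|a i s - b i s| <= d) /\
  forall (c : I -> R) (T : {set N}), (#|[set i | c i != 0%R]%SET| <= #|T|)%N ->
    (forall s, s \in T -> \sum_i c i * a i s = 0) -> forall i, c i = 0.
Proof.
move=> d0.
suff [a [ab aP]] : exists a : I -> N -> R, (forall i s, `|a i s - b i s| <= d) /\
  forall (c : I -> R) (T : {set N}), (forall i, i \notin enum I -> c i = 0) ->
  (#|[set i | c i != 0%R]%SET| <= #|T|)%N ->
    (forall s, s \in T -> \sum_i c i * a i s = 0) -> forall i, c i = 0.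
  by exists a; split => // c T; apply: aP => i; rewrite mem_enum.
elim: (enum I) => [|x l [a [ab aP]]].
  exists b; split=> [i s|c T c0 _ _ i]; last exact: c0.
  by rewrite subrr normr0 ltW.
pose W (k : {set I} * {set N}) (v : N -> R) := exists c : I -> R,
  (forall i, i \notin k.1 -> c i = 0) /\
  (forall s, s \in k.2 -> v s = \sum_i c i * a i s).
have [|||v [vb vW]] := @avoid_subspaces _
    [seq k : {set I} * {set N} <- enum {: {set I} * {set N}} | (#|k.1| < #|k.2|)%N] W (b x) d.
- move=> k v w vw [c [cJ cT]]; exists c; split => // s sT.
  by rewrite -vw cT.
- move=> k; rewrite mem_filter => /andP[kk _]; split.
    move=> p q v w [c [cJ cT]] [c' [cJ' cT']].
    exists (fun i => p * c i + q * c' i); split=> [i iJ|s sT].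
      by rewrite cJ// cJ'// !mulr0 addr0.
    rewrite cT// cT'// !mulr_sumr -big_split/=; apply: eq_bigr => i _.
    by rewrite mulrDl !mulrA.
  have [e eP] := span_proper a kk; exists e => -[c [cJ cT]].
  exact: (eP c).
- by [].
exists (fun i => if i == x then v else a i); split.
  by move=> i s; case: eqP => [->|_].
move=> c T cl cT cs.
have cx : c x = 0.
  apply/eqP; apply/negPn/negP => cx0.
  (* Solving the relation for [v] expresses it on [T] by the rest of the support of [c], which has
     fewer than |T| elements. *)
  apply: (vW (([set i | c i != 0%R] :\ x)%SET, T)).
    rewrite mem_filter mem_enum/= andbT; apply: leq_trans cT.
    by rewrite [in ltnRHS](cardsD1 x) inE cx0.
  exists (fun i => if i == x then 0 else - c i / c x); split=> /=.
    move=> i; rewrite !inE negb_and negbK; case: eqP => //= _.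
    by rewrite negbK => /eqP->; rewrite oppr0 mul0r.
  move=> s sT; have := cs s sT; rewrite (bigD1 x)//= eqxx.
  rewrite [in X in _ -> X](bigD1 x)//= eqxx mul0r add0r => /eqP.
  rewrite addr_eq0 => /eqP cxv.
  have -> : v s = (c x)^-1 * (c x * v s) by rewrite mulKf.
  rewrite cxv mulrN mulr_sumr -sumrN; apply: eq_bigr => i /negPf ix.
  by rewrite ix; lra.
apply: (aP c T) => //.
  move=> i il; have [->//|ix] := eqVneq i x.
  by apply: cl; rewrite inE negb_or ix.
move=> s sT; rewrite -[RHS](cs s sT); apply: eq_bigr => i _.
by case: eqP => // ->; rewrite cx !mul0r.
Qed.

End general_position.

(** * Invariant shapes and sets of small density *)

Section invariance.
Context (R : realType) (G : groupType).
Implicit Types (K S : {fset G}) (eps : R).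

(** The intersection of [S] with its translates g S, g in [K]. When [K] contains 1 it is the
    intersection in [invariant_shape], now as a finite set whose cardinality is a natural number. *)
Definition shape_core K S : {fset G} :=
  [fset s in S | all (fun g => (g^-1 * s)%g \in S) K]%fset.

Lemma counting_fset (T : choiceType) (A : {fset T}) :
  counting [set` A] = (#|` A|%:R)%:E :> \bar R.
Proof. by rewrite /counting asboolT ?set_fsetK//; exact: finite_fset. Qed.

Lemma le_counting (T : choiceType) (A B : set T) :
  A `<=` B -> (counting A <= counting B :> \bar R)%E.
Proof.
move=> AB; rewrite /counting; case: asboolP => fA; case: asboolP => fB;
  rewrite ?leey//.
- rewrite lee_fin ler_nat; apply: fsubset_leq_card; apply/fsubsetP => x.
  by rewrite !in_fset_set// !inE => /AB.
- by exfalso; apply: fA; apply: sub_finite_set AB fB.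
Qed.

Lemma bigcap_shape K S : 1%g \in K ->
  \bigcap_(g in [set` K]) ((fun s => (g * s)%g) @` [set` S]) =
  [set` shape_core K S].
Proof.
move=> K1; apply/seteqP; split=> [s H|s] /=.
  rewrite !inE/=; apply/andP; split.
    by have [t tS <-] := H _ K1; rewrite mul1g.
  by apply/allP => g gK; have [t tS <-] := H _ gK; rewrite mulKg.
rewrite !inE => /andP[sS /allP sK] g /= /sK gs.
by exists (g^-1 * s)%g; rewrite ?mulVKg.
Qed.

Lemma invariant_coreP K eps S : 1%g \in K -> invariant_shape K eps S ->
  (1 - eps) * #|` S|%:R < #|` shape_core K S|%:R.
Proof.
by move=> K1; rewrite /invariant_shape bigcap_shape// counting_fset lte_fin.
Qed.

Lemma invariant_core_sub K K' eps eps' S : 1%g \in K' ->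
  (forall g, g \in K -> g \in K') -> eps' <= eps ->
  (1 - eps') * #|` S|%:R < #|` shape_core K' S|%:R -> invariant_shape K eps S.
Proof.
move=> K1 KK ee; rewrite -lte_fin -counting_fset -bigcap_shape// => H.
rewrite /invariant_shape; apply: (@le_lt_trans _ _ ((1 - eps') * #|` S|%:R)%:E).
  by rewrite lee_fin ler_wpM2r// lerB.
apply: (lt_le_trans H); apply: le_counting => x Hx g gK; apply: Hx.
exact: KK.
Qed.

Lemma shape_core_sub K S g s : s \in shape_core K S -> g \in K ->
  (g^-1 * s)%g \in S.
Proof. by rewrite !inE => /andP[_ /allP]; apply. Qed.

Lemma card_rtranslate S c : #|` [fset (s * c)%g | s in S]%fset| = #|` S|.
Proof. by apply: card_imfset => x y /mulIg. Qed.

Lemma mem_rtranslate S c s : ((s * c)%g \in [fset (t * c)%g | t in S]%fset) = (s \in S).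
Proof.
apply/imfsetP/idP => [[t /= tS /mulIg->]//|sS].
by exists s.
Qed.

Lemma shape_core_rtranslate K S c :
  shape_core K [fset (s * c)%g | s in S]%fset =
  [fset (s * c)%g | s in shape_core K S]%fset.
Proof.
apply/fsetP => s; rewrite -[s](mulgVK c) mem_rtranslate !inE/= mem_rtranslate.
congr (_ && _); apply: eq_all => g; by rewrite mulgA mem_rtranslate.
Qed.

End invariance.

Section thin.
Context (R : realType) (G : groupType) (X : metricType R) (act : G -> X -> X).
Hypothesis act_action : continuous_action act.
Hypothesis X_compact : compact [set: X].

(** An upper density bound witnessed by one finite [F]. It counts group elements rather than points
    of the orbit, which makes it an inequality between sums of indicators, ready for integration. *)
Definition thin (eta : R) (Z : set X) := exists2 F : {fset G}, F != fset0 &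
  forall x, \sum_(g <- F) \1_Z (act g x) <= eta * #|` F|%:R :> R.

Lemma thin_mass eta Z : 0 <= eta -> closed Z -> thin eta Z -> mass_le act eta Z.
Proof.
move=> eta0 cZ [F F0 FZ] x0 mu mu_inv.
have mZ : measurable (Z : set (borel x0)) by exact: measurable_closed.
have F_gt0 : 0 < #|` F|%:R :> R by rewrite ltr0n cardfs_gt0.
have := @mass_transfer R G X act act_action x0 mu mu_inv G void F [::]
  (fun=> 1) (fun=> 0) id (fun=> 1%g) (fun=> Z) (fun=> set0) (eta * #|` F|%:R).
rewrite !big_nil !addr0.
under eq_bigr do rewrite mul1r.
rewrite -[\sum_(g <- F) _](_ : #|` F|%:R * mass mu Z = _); last first.
  rewrite card_fset_sum1 natr_sum mulr_suml; apply: eq_bigr => i _.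
  by rewrite mul1r.
move=> H; rewrite -(ler_pM2l F_gt0) [leRHS]mulrC; apply: H => //.
- by rewrite mulr_ge0.
- by move=> x; rewrite big_nil addr0; under eq_bigr do rewrite mul1r; exact: FZ.
Qed.

Lemma near_all (T : Type) (Fl : set_system T) (FF : Filter Fl) (K : choiceType)
    (s : seq K) (Q : K -> T -> Prop) :
  (forall g, g \in s -> \forall z \near Fl, Q g z) ->
  \forall z \near Fl, forall g, g \in s -> Q g z.
Proof.
elim: s => [|g s IH] H; first exact: nearW.
have H1 := H _ (mem_head _ _).
have H2 : \forall z \near Fl, forall g, g \in s -> Q g z.
  by apply: IH => h hs; apply: H; rewrite inE hs orbT.
apply: filterS (filterI H1 H2) => z [Qg Qs] h; rewrite inE => /predU1P[->//|]; exact: Qs.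
Qed.

(** Let a vanish exactly on [Z]. For y near x and t small, each g in [F] that brings y into {a < t}
    brings x into [Z], so the count at y is at most the count at x. Compactness makes t uniform. *)
Lemma thin_nbhd eta Z : closed Z -> thin eta Z ->
  exists O, [/\ open O, Z `<=` O & thin eta O].
Proof.
move=> cZ [F F0 FZ]; have [a [ca a01 aP]] := cozero (closed_openC cZ).
have a0 x : 0 <= a x by have /andP[] := a01 x.
pose O t := [set x | a x < t].
have := (compact_near_coveringP _).1 X_compact R (0^'+)
  (fun t x => \sum_(g <- F) \1_(O t) (act g x) <= eta * #|` F|%:R :> R) _.
case.
  move=> x _.
  have : filter_prod (nbhs x) (0^'+) (fun z : X * R =>
      forall g, g \in enum_fset F -> (O z.2 (act g z.1) -> Z (act g x))).
    refine (@near_all (X * R)%type (filter_prod (nbhs x) (0^'+)) _ G (enum_fset F)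
      (fun g z => O z.2 (act g z.1) -> Z (act g x)) _) => g _.
    have [Zg|nZ] := pselect (Z (act g x)); first by apply: nearW.
    have /aP ag : (~` Z) (act g x) by [].
    have ag2 : 0 < a (act g x) / 2 by rewrite divr_gt0.
    exists ([set y | a (act g x) / 2 < a (act g y)], [set t | t < a (act g x) / 2]).
      split => /=; last exact: (nbhs_right_lt ag2).
      apply: open_nbhs_nbhs; split=> /=; last by lra.
      exact: (open_gt_cont _ (cont_act act_action (g := g) ca)).
    by move=> [y t]/= [ay ta]; rewrite /O/= => at_; exfalso; lra.
  apply: filterS => -[y t] /= H; apply: le_trans (FZ x).
  rewrite big_seq [leRHS]big_seq; apply: ler_sum => g gF.
  rewrite !indicE; case: (boolP (act g y \in O t)) => //; rewrite inE => /H.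
  by move=> /(_ gF) Zg; rewrite mem_set.
move=> t /= t0 H; exists (O (t / 2)); split.
- exact: open_lt_cont.
- move=> x Zx; rewrite /O/=; have -> : a x = 0.
    by apply/eqP; rewrite eq_le a0 andbT leNgt; apply/negP => /aP.
  by rewrite divr_gt0.
- exists F => // x; have := H (t / 2) _ _ x I; apply.
    by rewrite /= sub0r normrN gtr0_norm ?divr_gt0//; lra.
  by rewrite divr_gt0.
Qed.

Hypothesis act_free : free_action act.

Lemma act_inj x : injective (act^~ x).
Proof.
move=> g h /= gh; have : act (h^-1 * g)%g x = x.
  by rewrite (actM act_action) gh (actK act_action).
by move=> /act_free hg; rewrite -[LHS](mulVKg h) hg mulg1.
Qed.

(** By freeness g -> g x is injective, so visits counted by group elements and by points of the
    orbit agree. *)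
Lemma density_thin eta (Z : set X) :
  (upper_banach_density R act Z < eta%:E)%E -> thin eta Z.
Proof.
move=> /ereal_inf_lt[_ [F /= F0 <-]] FZ; exists F => // x.
have F_gt0 : 0 < #|` F|%:R :> R by rewrite ltr0n cardfs_gt0.
pose E : {fset X} := [fset act g x | g in [fset g in F | act g x \in Z]%fset]%fset.
have -> : \sum_(g <- F) \1_Z (act g x) = #|` E|%:R :> R.
  rewrite /E card_imfset//=; last exact: act_inj.
  rewrite -[size _]/(#|` [fset g in F | act g x \in Z]%fset|) card_fset_sum1.
  rewrite -big_fset_condE natr_sum [RHS]big_mkcond/=.
  by apply: eq_bigr => g _; rewrite indicE; case: ifP.
rewrite -ler_pdivrMr// -lee_fin; apply: le_trans (ltW FZ).
apply: (@le_trans _ _ (counting (Z `&` (act^~ x @` [set` F])) * (#|` F|%:R^-1)%:E)%E).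
  rewrite EFinM lee_wpmul2r ?lee_fin ?invr_ge0// -counting_fset.
  apply: le_counting => y /= /imfsetP[g /=]; rewrite !inE => /andP[gF] /[!inE] Zg ->.
  by split => //; exists g.
by apply: ereal_sup_ubound; right; exists x.
Qed.

End thin.

(** * Castles given by cutoff functions *)

Lemma sum_at_most_one (R : realFieldType) (I : eqType) (r : seq I) (Q : I -> bool) :
  uniq r -> (forall a b, a \in r -> b \in r -> Q a -> Q b -> a = b) ->
  \sum_(a <- r) (Q a)%:R <= (has Q r)%:R :> R.
Proof.
elim: r => [|a r IH] /=; first by rewrite big_nil.
move=> /andP[ar ur] H; rewrite big_cons.
have {}IH := IH ur (fun b c br cr =>
  H b c (@mem_behead _ (a :: r) _ br) (@mem_behead _ (a :: r) _ cr)).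
case: (boolP (Q a)) => [Qa|_] /=; last by rewrite add0r.
rewrite big1_seq ?addr0// => b /andP[_ br].
case Qb : (Q b) => //; have e := H a b (mem_head _ _) (@mem_behead _ (a :: r) _ br) Qa Qb.
by rewrite e br in ar.
Qed.

Section soft_castles.
Context (R : realType) (G : groupType) (X : metricType R) (act : G -> X -> X).
Hypothesis act_action : continuous_action act.

(* Towers given by cutoff functions: the levels of tower i are the open sets
   s {u i > 0}, s in S i, and the part of it that is used is s {u i > 3/4}. *)
Definition soft_castle n (S : 'I_n -> {fset G}) (u : 'I_n -> X -> R) :=
  [/\ forall i, continuous (u i), forall i x, 0 <= u i x <= 1,
      forall i, 1%g \in S i
    & forall i j s t x, s \in S i -> t \in S j ->
        0 < u i (act s^-1%g x) -> 0 < u j (act t^-1%g x) -> i = j /\ s = t].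

Definition remainder n (S : 'I_n -> {fset G}) (u : 'I_n -> X -> R) : set X :=
  [set x | forall i s, s \in S i -> u i (act s^-1%g x) <= 3 / 4].

Section castle.
Context (n : nat) (S : 'I_n -> {fset G}) (u : 'I_n -> X -> R).
Hypothesis SU : soft_castle S u.

Lemma castle_cont i : continuous (u i). Proof. by case: SU. Qed.
Lemma castle_ge0 i x : 0 <= u i x.
Proof. by case: SU => _ /(_ i x)/andP[]. Qed.
Lemma castle_le1 i x : u i x <= 1.
Proof. by case: SU => _ /(_ i x)/andP[]. Qed.

Lemma closed_remainder : closed (remainder S u).
Proof.
have -> : remainder S u =
    \bigcap_(p in [set p : 'I_n * G | p.2 \in S p.1])
      [set x | u p.1 (act p.2^-1%g x) <= 3 / 4].
  by apply/seteqP; split=> [x H [i s]/= sS|x H i s sS]; [exact: H|exact: (H (i, s))].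
apply: closed_bigI => -[i s] _.
exact: (closed_le_cont (cont_act act_action (g := s^-1%g) (@castle_cont i))).
Qed.

Definition levels (P : 'I_n -> {fset G}) : seq ('I_n * G) :=
  [seq (i, p) | i <- enum 'I_n, p <- enum_fset (P i)].

Lemma mem_levels P i p : ((i, p) \in levels P) = (p \in P i).
Proof.
apply/allpairsPdep/idP => [[j [q [_ qP [-> ->]]]]//|pP].
by exists i, p; rewrite mem_enum.
Qed.

Lemma uniq_levels P : uniq (levels P).
Proof.
apply: allpairs_uniq_dep; first exact: enum_uniq.
- by move=> i _; exact: fset_uniq.
- by move=> [i p] [j q] _ _ /= [<- <-].
Qed.

Lemma sum_levels P (F : 'I_n -> G -> R) :
  \sum_(p <- levels P) F p.1 p.2 = \sum_i \sum_(p <- P i) F i p.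
Proof. by rewrite big_allpairs_dep/= big_enum. Qed.

Lemma sum_levels_le (P : 'I_n -> {fset G}) (B : 'I_n -> set X) (D : set X) x :
  (forall i p, p \in P i -> p \in S i) -> (forall i y, B i y -> 0 < u i y) ->
  (forall i p, p \in P i -> B i (act p^-1%g x) -> D x) ->
  \sum_(p <- levels P) \1_(B p.1) (act p.2^-1%g x) <= \1_D x :> R.
Proof.
case: SU => _ _ _ dS PS Bu BD.
have -> : \sum_(p <- levels P) \1_(B p.1) (act p.2^-1%g x) =
  \sum_(p <- levels P) (act p.2^-1%g x \in B p.1)%:R :> R.
  by apply: eq_bigr => p _; rewrite indicE.
apply: le_trans (sum_at_most_one _ _ _) _.
- exact: uniq_levels.
- move=> [i p] [j q]; rewrite !mem_levels !inE/= => pP qP Bi Bj.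
  by have [-> ->] := dS _ _ _ _ _ (PS _ _ pP) (PS _ _ qP) (Bu _ _ Bi) (Bu _ _ Bj).
rewrite indicE; case: hasP => // -[[i p]]; rewrite mem_levels inE/= => pP Bip.
by rewrite mem_set//; exact: (BD i p).
Qed.

Lemma mass_sum_levels P (B : 'I_n -> set X) (x0 : X) (mu : probability (borel x0) R) :
  \sum_(p <- levels P) 1 * mass mu (B p.1) =
  \sum_i #|` P i|%:R * mass mu (B i).
Proof.
rewrite (sum_levels P (fun i _ => 1 * mass mu (B i))).
apply: eq_bigr => i _; rewrite card_fset_sum1 natr_sum mulr_suml.
by [].
Qed.

Lemma mass_ge0 (x0 : X) (mu : probability (borel x0) R) (A : set X) : 0 <= mass mu A.
Proof. exact: fine_ge0. Qed.

(** The levels {u i > 3/4} cover everything but the remainder, so together they have mass at least 1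
    - [eta]. All levels of a tower have equal mass, hence a proportion [kappa] of the levels of each
    tower keeps that proportion of the mass. *)
Lemma castle_ge (eta kappa : R) (P : 'I_n -> {fset G}) (D : set X) :
  0 <= eta -> 0 <= kappa -> thin act eta (remainder S u) -> open D ->
  (forall i p, p \in P i -> p \in S i) ->
  (forall i, kappa * #|` S i|%:R <= #|` P i|%:R) ->
  (forall i p x, p \in P i -> 3 / 4 < u i (act p^-1%g x) -> D x) ->
  mass_ge act (kappa * (1 - eta)) D.
Proof.
move=> eta0 k0 thinZ oD PS cP PD x0 mu mu_inv.
pose B i : set X := [set x | 3 / 4 < u i x].
have mB i : measurable (B i : set (borel x0)).
  by apply: measurable_open; apply: open_gt_cont; exact: castle_cont.
have Bu i y : B i y -> 0 < u i y by rewrite /B/=; lra.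
have mD : measurable (D : set (borel x0)) by exact: measurable_open.
have cZ := closed_remainder.
have mZ : measurable (remainder S u : set (borel x0)) by exact: measurable_closed.
have muZ := thin_mass act_action eta0 cZ thinZ mu_inv.
have h1 : 1 - eta <= \sum_i #|` S i|%:R * mass mu (B i).
  have := @mass_transfer R G X act act_action x0 mu mu_inv unit _ [:: tt] (levels S)
    (fun=> 1) (fun=> 1) (fun=> 1%g) (fun p => p.2^-1%g) (fun=> ~` remainder S u)
    (fun p => B p.1) 0.
  rewrite mass_sum_levels add0r big_seq1 mul1r.
  have -> : mass mu (~` remainder S u) = 1 - mass mu (remainder S u).
    rewrite /mass probability_setC// fineB//; last exact: fin_num_measure.
  move=> H; apply: le_trans (H _ _ _ _ _ _) => //; first by rewrite lerB.
    by move=> _; exact: measurableC.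
  move=> x; rewrite big_seq1 mul1r add0r act1// indicE.
  under eq_bigr do rewrite mul1r.
  case: (boolP (x \in ~` remainder S u)) => [|_]; last by apply: sumr_ge0.
  rewrite inE => /existsNP[i /existsNP[s /not_implyP[sS /negP]]].
  rewrite -ltNge => Bis; rewrite (bigD1_seq (i, s)) ?uniq_levels ?mem_levels//=.
  by rewrite indicE mem_set// lerDl sumr_ge0.
have h2 : \sum_i #|` P i|%:R * mass mu (B i) <= mass mu D.
  have := @mass_transfer R G X act act_action x0 mu mu_inv _ unit (levels P) [:: tt]
    (fun=> 1) (fun=> 1) (fun p => p.2^-1%g) (fun=> 1%g) (fun p => B p.1) (fun=> D) 0.
  rewrite mass_sum_levels add0r big_seq1 mul1r; apply => //.
  move=> x; rewrite add0r big_seq1 mul1r act1//.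
  under eq_bigr do rewrite mul1r.
  by apply: sum_levels_le => // i p pP; exact: (PD i p).
apply: le_trans h2; apply: (@le_trans _ _ (kappa * \sum_i #|` S i|%:R * mass mu (B i))).
  by rewrite ler_wpM2l.
rewrite mulr_sumr; apply: ler_sum => i _; rewrite mulrA ler_wpM2r//.
exact: mass_ge0.
Qed.

(** Dual to the lower bound: the levels are disjoint, so their total mass is at most 1, and a
    proportion [q] of the levels of each tower has mass at most [q]. *)
Lemma castle_le (q : R) (Q : 'I_n -> {fset G}) (A : set X) :
  0 <= q -> closed A -> (forall i p, p \in Q i -> p \in S i) ->
  (forall i, #|` Q i|%:R <= q * #|` S i|%:R) ->
  (forall x, A x -> exists i p, p \in Q i /\ 3 / 4 <= u i (act p^-1%g x)) ->
  mass_le act q A.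
Proof.
move=> q0 cA QS cQ AQ x0 mu mu_inv.
pose B i : set X := [set x | 3 / 4 <= u i x].
have mB i : measurable (B i : set (borel x0)).
  by apply: measurable_closed; apply: closed_ge_cont; exact: castle_cont.
have Bu i y : B i y -> 0 < u i y by rewrite /B/=; lra.
have mA : measurable (A : set (borel x0)) by exact: measurable_closed.
have h1 : \sum_i #|` S i|%:R * mass mu (B i) <= 1.
  have := @mass_transfer R G X act act_action x0 mu mu_inv _ void (levels S) [::]
    (fun=> 1) (fun=> 1) (fun p => p.2^-1%g) (fun=> 1%g) (fun p => B p.1) (fun=> set0) 1.
  rewrite mass_sum_levels big_nil addr0; apply => //.
  move=> x; rewrite big_nil addr0; under eq_bigr do rewrite mul1r.
  by apply: le_trans (@sum_levels_le S B setT x _ _ _) _.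
have h2 : mass mu A <= \sum_i #|` Q i|%:R * mass mu (B i).
  have := @mass_transfer R G X act act_action x0 mu mu_inv unit _ [:: tt] (levels Q)
    (fun=> 1) (fun=> 1) (fun=> 1%g) (fun p => p.2^-1%g) (fun=> A) (fun p => B p.1) 0.
  rewrite mass_sum_levels add0r big_seq1 mul1r; apply => //.
  move=> x; rewrite big_seq1 mul1r add0r act1// indicE.
  under eq_bigr do rewrite mul1r.
  case: (boolP (x \in A)) => [|_]; last by apply: sumr_ge0.
  rewrite inE => /AQ[i [s [sQ Bis]]].
  rewrite (bigD1_seq (i, s)) ?uniq_levels ?mem_levels//=.
  by rewrite indicE mem_set// lerDl sumr_ge0.
apply: (le_trans h2); apply: (@le_trans _ _ (q * \sum_i #|` S i|%:R * mass mu (B i))).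
  rewrite mulr_sumr; apply: ler_sum => i _; rewrite mulrA ler_wpM2r//.
  exact: mass_ge0.
by rewrite -[leRHS]mulr1 ler_wpM2l.
Qed.

End castle.
End soft_castles.

(** * Existence of castles with cutoff functions, and visits to their levels *)

Section castle_existence.
Context (R : realType) (G : groupType) (X : metricType R) (act : G -> X -> X).
Hypothesis act_action : continuous_action act.
Hypothesis X_compact : compact [set: X].
Hypothesis act_free : free_action act.

Lemma thin_sub eta (Z O : set X) : Z `<=` O -> thin act eta O -> thin act eta Z.
Proof.
move=> ZO [F F0 FO]; exists F => // x; apply: le_trans (FO x).
apply: ler_sum => g _; rewrite !indicE; case: (boolP (_ \in Z)) => // /[!inE] /ZO Ox.
by rewrite mem_set.
Qed.

Lemma thin_le eta eta' (Z : set X) : eta <= eta' -> thin act eta Z -> thin act eta' Z.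
Proof.
move=> ee [F F0 FZ]; exists F => // x; apply: le_trans (FZ x) _.
by rewrite ler_wpM2r.
Qed.

(** For t in the core, the elements g^-1 t with g in [K] are distinct and lie in [S]. Adding many
    elements to [K] thus forces the shapes to be large. *)
Lemma card_le_core (K S : {fset G}) : (0 < #|` shape_core K S|)%N -> (#|` K| <= #|` S|)%N.
Proof.
rewrite cardfs_gt0 => /fset0Pn[t tK].
have <- : #|` [fset (g^-1 * t)%g | g in K]%fset| = #|` K|.
  by apply: card_imfset => g h /mulIg/invg_inj.
apply: fsubset_leq_card; apply/fsubsetP => _ /imfsetP[g /= gK ->].
exact: shape_core_sub tK gK.
Qed.

(** The remainder of a sharp castle is closed and thin, so it has a thin open neighbourhood [O]. Off
    [O] the levels become closed, and Urysohn functions equal to 1 there and supported in the open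
    bases leave a remainder inside [O]. *)
Lemma soft_castle_exists (K : {fset G}) (eps : R) (N : nat) :
  uniform_rokhlin R act -> infinite_set [set: G] -> 0 < eps ->
  exists n (S : 'I_n -> {fset G}) (u : 'I_n -> X -> R),
    [/\ soft_castle act S u, forall i, invariant_shape K eps (S i),
        forall i, (N <= #|` S i|)%N & thin act eps (remainder act S u)].
Proof.
move=> urp Ginf eps0.
have [B _ NB] := infinite_set_fset N Ginf.
pose K' := (1%g |` (K `|` B))%fset.
have K1 : 1%g \in K' by rewrite !inE eqxx.
(* With a tolerance at most 1, invariance forces the core to be nonempty, hence the shape to be as
   large as [K']. *)
pose e' := Num.min eps 1.
have e'0 : 0 < e' by rewrite lt_min eps0 ltr01.
have [n [S [V [[tow dtow] inv dens]]]] := urp K' e' e'0.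
have {}inv i := invariant_coreP K1 (inv i).
have core0 i : (0 < #|` shape_core K' (S i)|)%N.
  rewrite -(ltr0n R); apply: le_lt_trans (inv i); rewrite mulr_ge0//.
  by rewrite subr_ge0 ge_min lexx orbT.
have NS i : (N <= #|` S i|)%N.
  apply: leq_trans (card_le_core (core0 i)); apply: (leq_trans NB).
  by apply: fsubset_leq_card; apply/fsubsetP => x; rewrite !inE => ->; rewrite !orbT.
have oV i : open (V i) by have [] := tow i.
have disj i j s t x : s \in S i -> t \in S j ->
    V i (act s^-1%g x) -> V j (act t^-1%g x) -> i = j /\ s = t.
  move=> sS tS Vs Vt; have xs : (act s @` V i) x by rewrite act_image.
  have xt : (act t @` V j) x by rewrite act_image.
  have ij : i = j.
    apply: (dtow i j) => //; exists x; split; first by exists s.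
    by exists t.
  split => //; subst j; have [_ tr] := tow i.
  by apply: (tr s t) => //; exists x.
pose lev i s : set X := [set x | V i (act s^-1%g x)].
have olev i s : open (lev i s) by exact: (act_preimage_open act_action s^-1%g (oV i)).
pose Z0 := ~` \bigcup_i tower_union act (S i) (V i).
have Z0P x : ~ Z0 x -> exists i s, s \in S i /\ lev i s x.
  move=> /contrapT[i _ [s sS]]; rewrite act_image// => Vx.
  by exists i, s.
have cZ0 : closed Z0.
  apply: open_closedC; apply: bigcup_open => i _; apply: bigcup_open => s _.
  by rewrite act_image//; exact: olev.
have [ O [oO ZO thO]] :=
  thin_nbhd act_action X_compact cZ0 (density_thin act_action act_free dens).
(* Removing [O] and all other levels describes level (i, s) off [O] as the complement of an open
   set, hence as a closed set. *)
pose Lc i s : set X := ~` (O `|`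
  \bigcup_(p in [set p : 'I_n * G | p.2 \in S p.1 /\ p <> (i, s)]) lev p.1 p.2).
have LcV i s x : Lc i s x -> lev i s x.
  move=> /not_orP[nO nl]; have [|j [t [tS jt]]] := Z0P x; first by move=> /ZO.
  have [[<- <-]//|ne] := pselect ((j, t) = (i, s)).
  by exfalso; apply: nl; exists (j, t).
pose A i : set X := \bigcup_(s in [set` S i]) (act s @^-1` Lc i s).
have cA i : closed (A i).
  apply: closed_bigcup; first exact: finite_fset.
  move=> s _; apply: preimage_closed; first by move=> x _; exact: act_cont.
  apply: open_closedC; apply: openU => //; apply: bigcup_open => p _; exact: olev.
have AV i : A i `<=` V i.
  by move=> x [s sS] /= /LcV; rewrite /lev/= actK.
have ury i := urysohn_fun (cA i) (oV i) (@AV i).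
have /choice[u uP] := ury.
have cex i : exists c, c \in S i.
  have := core0 i; rewrite cardfs_gt0 => /fset0Pn[t].
  by rewrite !inE => /andP[]; exists t.
have /choice[c cS] := cex.
(* Recentring at an element [c i] of the shape: multiplying the shape by its inverse on the right
   and moving the base by it changes no level and no invariance, and puts 1 into the shape. *)
pose S' i := [fset (s * (c i)^-1)%g | s in S i]%fset.
pose u' i x := u i (act (c i)^-1%g x).
have S'P i s : s \in S' i -> exists2 s0, s0 \in S i & s = (s0 * (c i)^-1)%g.
  by move=> /imfsetP[s0 /= ? ->]; exists s0.
have u'E i s x : u' i (act (s * (c i)^-1)^-1%g x) = u i (act s^-1%g x).
  by rewrite /u' -actM// invgM invgK mulKg.
exists n, S', u'; split.
- split.
  + by move=> i; have [cu _ _ _] := uP i; exact: (cont_act act_action cu).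
  + by move=> i x; have [_ u01 _ _] := uP i; exact: u01.
  + by move=> i; rewrite -(mulgV (c i)) mem_rtranslate.
  + move=> i j s t x /S'P[s0 s0S ->] /S'P[t0 t0S ->]; rewrite !u'E => us ut.
    have [_ _ _ ui] := uP i; have [_ _ _ uj] := uP j.
    by have [e1 e2] := disj _ _ _ _ _ s0S t0S (ui _ us) (uj _ ut); subst.
- move=> i; apply: (@invariant_core_sub _ _ K K' eps e') => //.
  + by move=> g gK; rewrite !inE gK orbT.
  + by rewrite ge_min lexx.
  + by rewrite shape_core_rtranslate !card_rtranslate.
- by move=> i; rewrite card_rtranslate.
apply: thin_le (thin_sub _ thO); first by rewrite ge_min lexx.
move=> x xZ; apply: contrapT => nO.
have [|i [s [sS lx]]] := Z0P x; first by move=> /ZO.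
have := xZ i (s * (c i)^-1)%g; rewrite mem_rtranslate u'E => /(_ sS).
have [_ _ uA _] := uP i; suff As : A i (act s^-1%g x) by rewrite (uA _ As); lra.
exists s; first exact: sS.
rewrite /= actKV// => -[//|[[j t]/= [tS ne]] lt].
by have [e1 e2] := disj _ _ _ _ _ sS tS lx lt; apply: ne; subst.
Qed.

(** A visit at s in the core of [T] brings with it a full passage through a tower, at least [N]
    positions inside [T], and passages of different visits are disjoint. So the core holds at most
    |T| / N visits; outside it there are at most [eps] |T| positions. *)
Lemma visits_bound n (S : 'I_n -> {fset G}) (u : 'I_n -> X -> R)
    (a : 'I_n -> G) (N : nat) (eps : R) :
  soft_castle act S u -> (forall i, a i \in S i) ->
  (forall i, (N <= #|` S i|)%N) -> (0 < N)%N -> 0 < eps ->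
  exists K : {fset G}, 1%g \in K /\ forall T : {fset G},
    (1 - eps) * #|` T|%:R < #|` shape_core K T|%:R -> forall v,
    #|` [fset s in T | [exists i, 0 < u i (act (a i)^-1%g (act s v))]]%fset|%:R <=
      (N%:R^-1 + eps) * #|` T|%:R.
Proof.
move=> [_ _ _ dS] aS NS N0 eps0.
pose K := (1%g |` [fset (p.2 * (a p.1)^-1)^-1%g | p in levels S])%fset.
exists K; split; first by rewrite !inE eqxx.
move=> T invT v; pose vis s := [exists i, 0 < u i (act (a i)^-1%g (act s v))].
pose C := shape_core K T; pose W := [seq s <- enum_fset C | vis s].
have CT : {subset C <= T} by move=> s; rewrite !inE => /andP[].
have h1 : (#|` [fset s in T | vis s]%fset| <= size W + (#|` T| - #|` C|))%N.
  apply: (@leq_trans #|` ([fset s in C | vis s] `|` (T `\` C))%fset|).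
    apply: fsubset_leq_card; apply/fsubsetP => s; rewrite !inE => /andP[sT vs].
    by rewrite sT vs/= !andbT orbN.
  apply: leq_trans (leq_card_fsetU _ _) _.
  have cTC : #|` (T `\` C)%fset| = (#|` T| - #|` C|)%N.
    by rewrite cardfsDS//; apply/fsubsetP.
  rewrite cTC leq_add2r card_fset_sum1 -big_fset_condE/= sum1_count.
  by rewrite size_filter.
have h2 : (N * size W <= #|` T|)%N.
  have [|i0] := leqP n 0.
    rewrite leqn0 => /eqP n0; have -> : W = [::]; last by rewrite muln0.
    apply/eqP; rewrite -[_ == _]negbK -has_filter; apply/hasPn => s _.
    by apply/existsP => -[i]; have := leq_trans (ltn_ord i) (eq_leq n0).
  pose ix s : 'I_n := odflt (Ordinal i0) [pick i | 0 < u i (act (a i)^-1%g (act s v))].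
  have ixP s : s \in W -> 0 < u (ix s) (act (a (ix s))^-1%g (act s v)).
    rewrite mem_filter => /andP[/existsP[i ui] _]; rewrite /ix.
    by case: pickP => //= /(_ i); rewrite ui.
  (* The positions of these passages. A position y determines its visit, since y v lies in level [t]
     of tower [ix s] and in no other level. *)
  pose Y := [seq (t * (a (ix s))^-1 * s)%g | s <- W, t <- enum_fset (S (ix s))].
  have sY : (N * size W <= size Y)%N.
    rewrite size_allpairs_dep; elim: (W) => [|s w IH]; first by rewrite muln0.
    by rewrite /= mulnS leq_add// NS.
  apply: (leq_trans sY); apply: uniq_leq_size.
    apply: allpairs_uniq_dep.
    - by apply: filter_uniq; exact: fset_uniq.
    - by move=> s _; exact: fset_uniq.
    - move=> p q /allpairsPdep[s [t [sW tS ->]]] /allpairsPdep[s' [t' [sW' tS' ->]]] /=.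
      move=> e; have us := ixP _ sW; have us' := ixP _ sW'.
      pose x := act (t * (a (ix s))^-1 * s)%g v.
      have xs : act (a (ix s))^-1%g (act s v) = act t^-1%g x.
        by rewrite /x -!actM// !mulgA mulVg mul1g.
      have xs' : act (a (ix s'))^-1%g (act s' v) = act t'^-1%g x.
        by rewrite /x e -!actM// !mulgA mulVg mul1g.
      rewrite xs in us; rewrite xs' in us'.
      have [e1 e2] := dS _ _ _ _ _ tS tS' us us'.
      by move: e; rewrite e1 e2 => /mulgI ->.
  move=> y /allpairsPdep[s [t [sW tS ->]]].
  have sC : s \in C by move: sW; rewrite mem_filter => /andP[].
  have := @shape_core_sub G K T (t * (a (ix s))^-1)^-1%g s sC.
  rewrite invgK; apply; rewrite !inE; apply/orP; right.
  by apply/imfsetP; exists (ix s, t) => //=; rewrite mem_levels.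
have CT' : (#|` C| <= #|` T|)%N by apply: fsubset_leq_card; apply/fsubsetP.
rewrite mulrDl; apply: (@le_trans _ _ ((size W)%:R + (#|` T|%:R - #|` C|%:R))).
  by rewrite -natrB// -natrD ler_nat.
apply: lerD; last by move: invT; rewrite -/C; lra.
by rewrite ler_pdivlMl ?ltr0n// -natrM ler_nat.
Qed.

End castle_existence.

(** * Coding disjointly supported functions *)

Lemma pow_half_small (R : realType) (e : R) : 0 < e -> exists n, 2 * 2^-1 ^+ n < e :> R.
Proof.
move=> e0; have := @cvg_geometric R 2 2^-1; rewrite ger0_norm ?invr_ge0//.
rewrite invf_lt1 ?ltr1n// => /(_ isT) /cvgrPdist_lt/(_ e e0)[n _ /(_ n (leqnn n))] /=.
rewrite sub0r normrN ger0_norm; first by exists n.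
by rewrite /geometric/= mulr_ge0// exprn_ge0.
Qed.

Section coding.
Context (R : realType) (X : metricType R).

(** The terms are bounded by 2^-n, n the code of the index, so the partial sums converge uniformly.
    At a given point all but one of the terms vanish. *)
Lemma disjoint_series (T : countType) (w : T -> X -> R) (c : T -> R) :
  (forall t, continuous (w t)) -> (forall t x, 0 <= w t x <= 1) ->
  (forall s t x, 0 < w s x -> 0 < w t x -> s = t) ->
  (forall t, 0 <= c t <= 2^-1 ^+ (choice.pickle t)) ->
  exists H : X -> R, [/\ continuous H, forall t x, 0 < w t x -> H x = c t * w t x
    & forall x, (forall t, w t x = 0) -> H x = 0].
Proof.
move=> cw w01 dw c01.
have w0 t x : 0 <= w t x by have /andP[] := w01 t x.
pose f n x : R := oapp (fun t => c t * w t x) 0 ((choice.pickle_inv n : option T)).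
have f01 n x : 0 <= f n x <= 2^-1 ^+ n.
  rewrite /f; case E : choice.pickle_inv => [t|] /=; last first.
    by rewrite lexx/=; apply: exprn_ge0; lra.
  have := choice.pickle_invK (T := T) n; rewrite E /= => <-.
  have /andP[c0 c1] := c01 t; have /andP[_ w1] := w01 t x.
  by rewrite mulr_ge0//= -[leRHS]mulr1 ler_pM.
have cf n : continuous (f n).
  rewrite /f; case: choice.pickle_inv => [t|] /=; last exact: contC.
  apply: contM; [exact: contC|exact: cw].
pose u n x := \sum_(i < n) f i x.
have [||H [cH uH]] := @uniform_limit R X u.
- by move=> n; apply: cont_sum => i _; exact: cf.
- move=> n x.
  have -> : u n.+1 x - u n x = f n x by rewrite /u big_ord_recr/= addrAC subrr add0r.
  by have /andP[f0 f1] := f01 n x; rewrite ger0_norm.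
exists H; split => //.
- move=> t x wt.
  have ft n : n != choice.pickle t -> f n x = 0.
    rewrite /f; case E : choice.pickle_inv => [s|] //= nt.
    have [ws|ws] := ltP 0 (w s x); last first.
      by rewrite (_ : w s x = 0) ?mulr0//; apply/eqP; rewrite eq_le ws w0.
    have st := dw _ _ _ ws wt; subst s; move: nt.
    by have := choice.pickle_invK (T := T) n; rewrite E /= => ->; rewrite eqxx.
  have un n : (choice.pickle t < n)%N -> u n x = c t * w t x.
    move=> tn; rewrite /u (bigD1 (Ordinal tn))//= big1 ?addr0; last first.
      by move=> i ne; apply: ft; apply: contraNneq ne => e; apply/eqP/val_inj.
    by rewrite /f choice.pickleK_inv.
  apply/eqP; rewrite -subr_eq0; apply/eqP; apply: contrapT => /eqP ne.
  have nx : 0 < `|H x - c t * w t x| by rewrite normr_gt0.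
  have [n nlt] := pow_half_small nx.
  have := uH (n + (choice.pickle t).+1)%N x; rewrite un; last by rewrite addnS ltnS leq_addl.
  apply/negP; rewrite -ltNge; apply: le_lt_trans nlt.
  by rewrite ler_pM2l// exprD ler_piMr ?exprn_ge0//; apply: exprn_ile1; lra.
- move=> x wx; have un n : u n x = 0.
    rewrite /u big1// => i _; rewrite /f; case: choice.pickle_inv => //= t.
    by rewrite wx mulr0.
  apply/eqP; apply: contrapT => /negP ne.
  have nx : 0 < `|H x| by rewrite normr_gt0.
  have [n nlt] := pow_half_small nx.
  by have := uH n x; rewrite un subr0 leNgt nlt.
Qed.

(* On the support of w t, with n the code of t, the pair (H 0, H 1) is
   2^-n (w t) (1, 1/(n + 1)), so that H 1 / H 0 reveals t. *)
Lemma disjoint_code (T : countType) (w : T -> X -> R) :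
  (forall t, continuous (w t)) -> (forall t x, 0 <= w t x <= 1) ->
  (forall s t x, 0 < w s x -> 0 < w t x -> s = t) ->
  exists H : 'I_2 -> X -> R, [/\ forall l, continuous (H l),
    forall l x, 0 <= H l x <= 1, forall l x, 0 < H l x -> exists t, 0 < w t x
    & forall x y, (forall l, H l x = H l y) -> forall t, w t x = w t y].
Proof.
move=> cw w01 dw.
have w0 t x : 0 <= w t x by have /andP[] := w01 t x.
pose q n : R := 2^-1 ^+ n.
have q0 n : 0 < q n by rewrite exprn_gt0// invr_gt0.
have q1 n : q n <= 1 by apply: exprn_ile1; lra.
pose d n : R := (n.+1)%:R^-1.
have d0 n : 0 < d n by rewrite invr_gt0 ltr0n.
have d1 n : d n <= 1 by rewrite invf_le1 ?ltr0n// ler1n.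
have q0' n : 0 <= q n by exact: ltW.
have d0' n : 0 <= d n by exact: ltW.
have [|H1 [cH1 H1w H10]] := @disjoint_series T w (fun t => q (choice.pickle t)) cw w01 dw.
  by move=> t; rewrite lexx andbT q0'.
have [|H2 [cH2 H2w H20]] := @disjoint_series T w
    (fun t => q (choice.pickle t) * d (choice.pickle t)) cw w01 dw.
  by move=> t; rewrite mulr_ge0//= ler_piMr.
have alt x : (exists t, 0 < w t x) \/ (forall t, w t x = 0).
  have [|n] := pselect (exists t, 0 < w t x); [by left|right => t].
  by apply/eqP; rewrite eq_le w0 andbT leNgt; apply/negP => wt; apply: n; exists t.
have w1 t x : w t x <= 1 by have /andP[] := w01 t x.
pose H (l : 'I_2) := if l == 0 then H1 else H2.
exists H; split.
- by move=> l; rewrite /H; case: ifP.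
- move=> l x; have [[t wt]|z] := alt x; last first.
    by rewrite /H; case: ifP => _; rewrite ?H10 ?H20// lexx ler01.
  rewrite /H; case: ifP => _; rewrite ?(H1w _ _ wt) ?(H2w _ _ wt).
    by rewrite mulr_ge0//= mulr_ile1.
  by rewrite mulr_ge0 ?mulr_ge0//= mulr_ile1 ?mulr_ge0// mulr_ile1.
- move=> l x Hx; have [//|z] := alt x.
  by move: Hx; rewrite /H; case: ifP => _; rewrite ?H10 ?H20// ltxx.
- move=> x y e.
  have e1 : H1 x = H1 y := e 0; have e2 : H2 x = H2 y := e 1.
  have [[t wt]|zx] := alt x; have [[s ws]|zy] := alt y; last first.
  + by move=> t; rewrite zx zy.
  + move: e1; rewrite H10// (H1w _ _ ws) => /esym/eqP.
    by rewrite mulf_eq0 gt_eqF//= gt_eqF.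
  + move: e1; rewrite [RHS]H10// (H1w _ _ wt) => /eqP.
    by rewrite mulf_eq0 gt_eqF//= gt_eqF.
  move: e1 e2; rewrite (H1w _ _ wt) (H1w _ _ ws) (H2w _ _ wt) (H2w _ _ ws).
  rewrite ![_ * d _ * _]mulrAC => e1; rewrite e1 => e2.
  have st : s = t.
    apply: (pcan_inj (@choice.pickleK T)); apply/eqP; rewrite -eqSS -(eqr_nat R).
    rewrite -[eqbLHS]invrK -[eqbRHS]invrK; apply/eqP; congr (_^-1).
    have /mulfI : q (choice.pickle s) * w s y != 0 by rewrite mulf_neq0 ?gt_eqF.
    by move=> /(_ _ _ e2).
  subst s; have wxy : w t x = w t y.
    have /mulfI : q (choice.pickle t) != 0 by rewrite gt_eqF.
    by move=> /(_ _ _ e1).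
  move=> r; have [->//|ne] := eqVneq r t.
  have z v : 0 < w t v -> w r v = 0.
    move=> wtv; apply/eqP; rewrite eq_le w0 andbT leNgt; apply/negP => wr.
    by move: ne; rewrite (dw _ _ _ wr wtv) eqxx.
  by rewrite !z.
Qed.

End coding.

(** * Frozen slots *)

Section markers.
Context (R : realType) (G : groupType) (X : metricType R) (act : G -> X -> X).
Hypothesis act_action : continuous_action act.
Hypothesis X_compact : compact [set: X].
Hypothesis act_free : free_action act.
Hypothesis urp : uniform_rokhlin R act.
Hypothesis G_infinite : infinite_set [set: G].

Let castle_ex := fun K eps N => @soft_castle_exists R G X act act_action
  X_compact act_free K eps N urp G_infinite.

Lemma shape_core_mono (K K' S : {fset G}) : (forall g, g \in K -> g \in K') ->
  (#|` shape_core K' S| <= #|` shape_core K S|)%N.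
Proof.
move=> KK; apply: fsubset_leq_card; apply/fsubsetP => s; rewrite !inE.
by move=> /andP[-> /allP H]; apply/allP => g /KK; exact: H.
Qed.

(** There are finitely many towers, so one level of each is at least a fixed positive proportion [k]
    of every tower. *)
Lemma single_level_ge n (S : 'I_n -> {fset G}) (u : 'I_n -> X -> R)
    (a : 'I_n -> G) (D : set X) :
  soft_castle act S u -> thin act 2^-1 (remainder act S u) ->
  (forall i, a i \in S i) -> open D ->
  (forall i x, 3 / 4 < u i (act (a i)^-1%g x) -> D x) ->
  exists2 c : R, 0 < c & mass_ge act c D.
Proof.
move=> SU thS aS oD aD; pose k : R := (1 + \sum_i #|` S i|%:R)^-1.
have k0 : 0 < 1 + \sum_i #|` S i|%:R :> R by rewrite ltr_pwDl// sumr_ge0.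
exists (k * (1 - 2^-1)); first by rewrite mulr_gt0 ?invr_gt0//; lra.
apply: (castle_ge act_action SU (P := fun i => [fset a i]%fset)) => //.
- by rewrite invr_ge0 ltW.
- by move=> i p; rewrite inE => /eqP->.
- move=> i; rewrite cardfs1 mulrC ler_pdivrMr// mul1r (bigD1 i)//= addrCA lerDl.
  by rewrite addr_ge0// sumr_ge0.
- by move=> i p x; rewrite inE => /eqP->; exact: aD.
Qed.

(** The three slots are the levels [e l * c i] of a castle whose shapes contain three such elements;
    [beta] is the sum of the cutoff functions moved to level [c i]. Tall towers make visits to the
    slots rare. *)
Lemma slots_exist (q : R) : 0 < q ->
  exists (beta : X -> R) (e : 'I_3 -> G),
    [/\ [/\ continuous beta, forall x, 0 <= beta x <= 1 & e 0 = 1%g],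
        forall l l' x, 0 < beta (act (e l)^-1%g x) ->
          0 < beta (act (e l')^-1%g x) -> l = l',
        exists2 c : R, 0 < c & mass_ge act c [set x | 1 / 2 < beta x]
      & exists K (eps : R), [/\ 0 < eps, 1%g \in K & forall T : {fset G},
          (1 - eps) * #|` T|%:R < #|` shape_core K T|%:R -> forall v,
          #|` [fset s in T | [exists l, 0 < beta (act (e l)^-1%g (act s v))]]%fset|%:R
            <= q * #|` T|%:R]].
Proof.
move=> q0.
have Ginf1 : infinite_set ([set: G] `\ 1%g).
  by apply: infinite_setD => //; exact: finite_set1.
have [B B1 cB] := infinite_set_fset 2 Ginf1.
have uB : uniq (1%g :: enum_fset B).
  by rewrite /= fset_uniq andbT; apply/negP => /B1[_]; exact.
pose e (l : 'I_3) : G := nth 1%g (1%g :: enum_fset B) l.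
have inj_e : injective e.
  move=> l l' /eqP; rewrite nth_uniq//; first by move=> /eqP/val_inj.
  - exact: leq_trans (ltn_ord l) _.
  - exact: leq_trans (ltn_ord l') _.
(* Each of the three slots is visited with frequency at most 1/N + [eps], which is at most 2
   [eps]. *)
pose eps := q / 6.
have eps0 : 0 < eps by rewrite divr_gt0.
pose N := (Num.truncn eps^-1).+1.
have N0 : (N%:R : R)^-1 <= eps.
  rewrite -[leRHS]invrK lef_pV2 ?posrE ?ltr0n ?invr_gt0//.
  by apply: ltW; rewrite /N truncnS_gt.
(* With the inverses of the [e l] in [K0], any [c] in the core of a shape has all [e l * c] in the
   shape. *)
pose K0 := (1%g |` [fset (e l)^-1%g | l : 'I_3])%fset.
have half0 : 0 < 2^-1 :> R by rewrite invr_gt0.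
have [n [S [u [SU inv NS thS]]]] := castle_ex K0 N half0.
have cex i : exists c, forall l, (e l * c)%g \in S i.
  have K1 : 1%g \in K0 by rewrite !inE eqxx.
  have := invariant_coreP K1 (inv i); rewrite -[X in _ < X -> _]opprK => H.
  have : (0 < #|` shape_core K0 (S i)|)%N.
    rewrite -(ltr0n R) -[ltRHS]opprK; apply: le_lt_trans H.
    by rewrite mulr_ge0//; lra.
  rewrite cardfs_gt0 => /fset0Pn[c cS]; exists c => l.
  have := @shape_core_sub G K0 (S i) (e l)^-1%g c cS; rewrite invgK; apply.
  by rewrite !inE; apply/orP; right; apply/imfsetP; exists l.
have [c cS] := choice cex.
have e00 : e 0 = 1%g by [].
have u0 i x : 0 <= u i x by exact: (castle_ge0 SU).
pose beta x := \sum_i u i (act (c i)^-1%g x).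
have dS : forall i j s t x, s \in S i -> t \in S j ->
        0 < u i (act s^-1%g x) -> 0 < u j (act t^-1%g x) -> i = j /\ s = t.
  by case: SU.
have betaE i l x : 0 < u i (act (e l * c i)^-1%g x) ->
    beta (act (e l)^-1%g x) = u i (act (e l * c i)^-1%g x).
  move=> ui; rewrite /beta (bigD1 i)//= big1 ?addr0; last first.
    move=> j ji; apply/eqP; rewrite eq_le u0 andbT leNgt; apply/negP => uj.
    rewrite -actM// -invgM in uj.
    by have [ij _] := dS _ _ _ _ _ (cS i l) (cS j l) ui uj; rewrite ij eqxx in ji.
  by rewrite -actM// -invgM.
have beta_ex l x : 0 < beta (act (e l)^-1%g x) ->
    exists i, 0 < u i (act (e l * c i)^-1%g x).
  move=> b0; apply: contrapT => /forallNP H; move: b0.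
  rewrite /beta big1 ?ltxx// => i _; rewrite -actM// -invgM.
  by apply/eqP; rewrite eq_le u0 andbT leNgt; apply/negP.
exists beta, e; split.
- split => //.
    by apply: cont_sum => i _; exact: (cont_act act_action (@castle_cont _ _ _ _ _ _ _ SU i)).
  move=> x; rewrite sumr_ge0//=.
  have [b0|] := ltP 0 (beta x); last by move=> /le_trans; apply.
  have x1 : x = act (e 0)^-1%g x by rewrite e00 invg1 act1.
  rewrite -/(beta x) x1 in b0 *; have [i ui] := beta_ex _ _ b0.
  by rewrite (betaE i)//; exact: (castle_le1 SU).
- move=> l l' x /beta_ex[i ui] /beta_ex[j uj].
  have [ij] := dS _ _ _ _ _ (cS i l) (cS j l') ui uj.
  by subst j => /mulIg/inj_e.
- apply: (single_level_ge SU thS (a := c)) => //.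
  + by move=> i; have := cS i 0; rewrite e00 mul1g.
  + apply: open_gt_cont; apply: cont_sum => i _.
    exact: (cont_act act_action (@castle_cont _ _ _ _ _ _ _ SU i)).
  + move=> i x /= ui; have := betaE i 0 x; rewrite e00 mul1g invg1 act1//.
    by move=> ->; lra.
have vb l := visits_bound act_action SU (a := fun i => (e l * c i)%g) (cS ^~ l) NS isT eps0.
have [K KP] := choice vb.
pose KK := (1%g |` \big[fsetU/fset0]_(l < 3) K l)%fset.
exists KK, eps; split => //; first by rewrite !inE eqxx.
move=> T invT v.
have KKl l : (1 - eps) * #|` T|%:R < #|` shape_core (K l) T|%:R.
  apply: (lt_le_trans invT); rewrite ler_nat; apply: shape_core_mono => g gK.
  by rewrite !inE; apply/orP; right; apply/bigfcupP; exists l; rewrite ?mem_index_enum.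
pose W l := [fset s in T | [exists i, 0 < u i (act (e l * c i)^-1%g (act s v))]]%fset.
have cW l : #|` W l|%:R <= (N%:R^-1 + eps) * #|` T|%:R by have [_] := KP l; exact.
apply: (@le_trans _ _ (\sum_l #|` W l|%:R)).
  rewrite -natr_sum ler_nat.
  apply: (@leq_trans #|` \big[fsetU/fset0]_(l < 3) W l|%fset).
    apply: fsubset_leq_card; apply/fsubsetP => s; rewrite !inE => /andP[sT].
    move=> /existsP[l /beta_ex[i ui]]; apply/bigfcupP; exists l.
      by rewrite mem_index_enum.
    by rewrite !inE sT; apply/existsP; exists i.
  elim/big_ind2 : _ => [|m1 A1 m2 A2 h1 h2|//]; first by rewrite cardfs0.
  exact: leq_trans (leq_card_fsetU _ _) (leq_add h1 h2).
apply: (@le_trans _ _ (\sum_(l < 3) (N%:R^-1 + eps) * #|` T|%:R)).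
  by apply: ler_sum => l _; exact: cW.
rewrite sumr_const card_ord -[_ *+ _]mulr_natl mulrA ler_wpM2r//.
by rewrite /eps in N0 *; lra.
Qed.

End markers.

(** * Castles decodable from the frozen slots *)

Section decodable.
Context (R : realType) (G : groupType) (X : metricType R) (act : G -> X -> X).
Hypothesis act_action : continuous_action act.
Hypothesis X_compact : compact [set: X].
Hypothesis act_free : free_action act.
Hypothesis urp : uniform_rokhlin R act.
Hypothesis cmp : has_comparison R act.
Hypothesis G_infinite : infinite_set [set: G].

Let castle_ex := fun K eps N => @soft_castle_exists R G X act act_action
  X_compact act_free K eps N urp G_infinite.

(** The pieces of [A] cover it and their translates are disjoint in [W], so moving them loses no
    mass for any invariant measure. *)
Lemma mass_ge_image n (U : 'I_n -> set X) (g : 'I_n -> G) (A W : set X) (c : R) :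
  open A -> open W -> (forall j, open (U j)) ->
  (forall x, A x -> exists j, U j x) ->
  (forall j x, A x -> U j x -> W (act (g j) x)) ->
  (forall i j x y, U i x -> U j y -> act (g i) x = act (g j) y -> i = j /\ x = y) ->
  mass_ge act c A -> mass_ge act c W.
Proof.
move=> oA oW oU AU UW dU cA x0 mu mu_inv; apply: (le_trans (cA x0 mu mu_inv)).
pose B j := U j `&` A.
have mB j : measurable (B j : set (borel x0)).
  by apply: measurable_open; exact: openI.
have mA : measurable (A : set (borel x0)) by exact: measurable_open.
have mW : measurable (W : set (borel x0)) by exact: measurable_open.
have h1 : mass mu A <= \sum_j 1 * mass mu (B j).
  have := @mass_transfer R G X act act_action x0 mu mu_inv unit _ [:: tt] (index_enum 'I_n)
    (fun=> 1) (fun=> 1) (fun=> 1%g) (fun=> 1%g) (fun=> A) B 0.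
  rewrite add0r big_seq1 mul1r; apply => //.
  move=> x; rewrite big_seq1 mul1r add0r act1// indicE.
  case: (boolP (x \in A)) => [|_]; last by apply: sumr_ge0.
  rewrite inE => Ax; have [j Ujx] := AU _ Ax; rewrite (bigD1 j)//= mul1r indicE mem_set//.
  by rewrite lerDl; apply: sumr_ge0.
apply: (le_trans h1).
have := @mass_transfer R G X act act_action x0 mu mu_inv _ unit (index_enum 'I_n) [:: tt]
    (fun=> 1) (fun=> 1) (fun j => (g j)^-1%g) (fun=> 1%g) B (fun=> W) 0.
rewrite add0r big_seq1 mul1r; apply => //.
move=> x; rewrite big_seq1 mul1r add0r act1//.
have -> : \sum_j 1 * \1_(B j) (act (g j)^-1%g x) =
    \sum_j (act (g j)^-1%g x \in B j)%:R :> R.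
  by apply: eq_bigr => j _; rewrite mul1r indicE.
apply: le_trans (sum_at_most_one _ _ _) _.
- exact: index_enum_uniq.
- move=> i j _ _; rewrite !inE => -[Ui _] [Uj _].
  by have [|-> _] := dU _ _ _ _ Ui Uj; rewrite ?actKV.
rewrite indicE; case: hasP => // -[j _]; rewrite inE => -[Uj Aj].
by rewrite mem_set//; have := UW _ _ Aj Uj; rewrite actKV.
Qed.

(** Two levels of each tower of a tall castle have total mass below [c], so comparison moves both
    into [E]. Their images are disjoint, and each keeps the mass of its level. *)
Lemma split_open (E : set X) (c : R) : open E -> 0 < c -> mass_ge act c E ->
  exists (W : bool -> set X), [/\ forall b, open (W b), forall b, W b `<=` E,
    W true `&` W false = set0 & forall b, exists2 c' : R, 0 < c' & mass_ge act c' (W b)].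
Proof.
move=> oE c0 cE.
(* Large enough for 2 / N < [c], and at least 2, so that each shape contains an element other than
   1. *)
pose N := (Num.truncn (2 / c)).+2.
have half0 : 0 < 2^-1 :> R by rewrite invr_gt0.
have [n [S [u [SU _ NS thS]]]] := castle_ex fset0 N half0.
have [cu u01 S1 dS] := SU.
have NR : 2 < c * N%:R.
  rewrite mulrC -ltr_pdivrMr//; apply: (lt_trans (truncnS_gt _)).
  by rewrite ltr_nat.
have aex i : exists a, a \in S i /\ a <> 1%g.
  have : (1 < #|` S i|)%N by apply: leq_trans (NS i).
  rewrite (cardfsD1 1%g) S1 ltnS cardfs_gt0 => /fset0Pn[a].
  by rewrite !inE => /andP[/eqP]; exists a.
have [a aP] := choice aex.
pose b0 (b : bool) i := if b then a i else 1%g.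
have bS b i : b0 b i \in S i by case: b => /=; [have [] := aP i|exact: S1].
pose Q i := [fset 1%g; a i]%fset.
pose A : set X := [set x | exists i p, p \in Q i /\ 3 / 4 <= u i (act p^-1%g x)].
have cA : closed A.
  have -> : A = \bigcup_(p in [set` [fset q in levels Q]%fset])
      [set x | 3 / 4 <= u p.1 (act p.2^-1%g x)].
    apply/seteqP; split=> [x [i [p [pQ up]]]|x [[i p] /=]].
      by exists (i, p) => //=; rewrite inE mem_levels.
    by rewrite inE mem_levels => pQ up; exists i, p.
  apply: closed_bigcup; first exact: finite_fset.
  move=> [i p] _; exact: (closed_ge_cont (cont_act act_action (g := p^-1%g) (cu i))).
have N0 : 0 < N%:R :> R by rewrite ltr0n.
have lA : mass_le act (2 / N%:R) A.
  apply: (castle_le act_action SU (Q := Q)) => //.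
  - by move=> i p; rewrite !inE => /orP[]/eqP-> //; have [] := aP i.
  - move=> i; rewrite mulrAC ler_pdivlMr//.
    apply: (@le_trans _ _ (2 * N%:R)).
      by rewrite ler_wpM2r// ler_nat cardfs2; case: (_ != _).
    by rewrite ler_wpM2l// ler_nat.
have NC : 2 / N%:R < c by rewrite ltr_pdivrMr.
have [m [U [g [oU AU UE dU]]]] := comparison_mass act_action cmp cA oE lA cE NC.
pose lev b x := exists i, 3 / 4 < u i (act (b0 b i)^-1%g x).
have olev b : open [set x | lev b x].
  have -> : [set x | lev b x] = \bigcup_i [set x | 3 / 4 < u i (act (b0 b i)^-1%g x)].
    by apply/seteqP; split=> x [i]; [exists i|exists i].
  apply: bigcup_open => i _.
  exact: (open_gt_cont _ (cont_act act_action (g := (b0 b i)^-1%g) (cu i))).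
pose W b : set X := [set y | exists j, U j (act (g j)^-1%g y) /\ lev b (act (g j)^-1%g y)].
have oW b : open (W b).
  have -> : W b = \bigcup_j (act (g j)^-1%g @^-1` (U j `&` [set x | lev b x])).
    by apply/seteqP; split=> x [j]; exists j.
  apply: bigcup_open => j _; apply: act_preimage_open => //; exact: openI.
exists W; split => //.
- by move=> b y [j [Uj _]]; have := UE _ _ Uj; rewrite actKV.
- rewrite -subset0 => y [[j [Uj [i ui]]] [j' [Uj' [i' ui']]]].
  have [|jj e] := dU _ _ _ _ Uj Uj'; first by rewrite !actKV.
  subst j'; have [ii aa] := dS _ _ _ _ _ (bS true i) (bS false i')
    ltac:(lra) ltac:(lra).
  by subst i'; have [_] := aP i; apply.
move=> b; have [c' c'0 cl] : exists2 c' : R, 0 < c' & mass_ge act c' [set x | lev b x].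
  apply: (single_level_ge act_action SU thS (a := b0 b)) => //.
  by move=> i x ui; exists i.
exists c' => //; apply: (mass_ge_image (olev b) (oW b) oU _ _ dU cl).
- move=> x [i ui]; apply: AU; exists i, (b0 b i); split; last exact: ltW.
  by rewrite /Q /b0 !inE; case: (b); rewrite eqxx ?orbT.
- by move=> j x lx Ux; exists j; rewrite actK.
Qed.

(** Repeated splitting: the half [true] is kept and the half [false] is split again. This gives a
    region of [E] for the markers of each castle of a sequence. *)
Lemma disjoint_open_seq (E : set X) (c : R) : open E -> 0 < c -> mass_ge act c E ->
  exists D : nat -> set X, [/\ forall n, open (D n), forall n, D n `<=` E,
    forall m n x, D m x -> D n x -> m = n
    & forall n, exists2 c' : R, 0 < c' & mass_ge act c' (D n)].
Proof.
move=> oE c0 cE.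
pose good (E : set X) := open E /\ exists2 c : R, 0 < c & mass_ge act c E.
have H (F : {F | good F}) : exists W : bool -> set X,
    [/\ forall b, good (W b), forall b, W b `<=` sval F & W true `&` W false = set0].
  case: F => F [oF [d d0 dF]] /=; have [W [oW WF dW mW]] := split_open oF d0 dF.
  by exists W; split => // b; split.
have [W WP] := choice H.
have gW F b : good (W F b) by have [] := WP F.
have gE : good E by split => //; exists c.
pose F n := iter n (fun F => exist good _ (gW F false)) (exist good E gE).
have FS n : sval (F n.+1) = W (F n) false by [].
have Fmono m n : (m <= n)%N -> sval (F n) `<=` sval (F m).
  elim: n => [|n IH]; first by rewrite leqn0 => /eqP->.
  rewrite leq_eqVlt => /predU1P[->//|]; rewrite ltnS => /IH; apply: subset_trans.
  by rewrite FS; have [_ + _] := WP (F n); exact.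
exists (fun n => W (F n) true); split.
- by move=> n; have [] := gW (F n) true.
- move=> n; apply: (@subset_trans _ (sval (F n))); first by have [_ + _] := WP (F n); exact.
  exact: (Fmono 0%N n).
- move=> m n x; wlog mn : m n / (m < n)%N.
    move=> wl Dm Dn; have [mn|nm|//] := ltngtP m n; first exact: wl.
    by apply/esym; exact: wl.
  move=> Dm Dn; exfalso; have [_ Wn _] := WP (F n).
  have := Fmono _ _ mn _ (Wn _ _ Dn); rewrite FS => Dm'.
  have [_ _ Wm] := WP (F m); have : (W (F m) true `&` W (F m) false) x by [].
  by rewrite Wm.
- by move=> n; have [] := gW (F n) true.
Qed.

Section markers.
Context (E : set X).

(** The weaker threshold for [y] is deliberate: the marker coded by [H] is positive exactly where u
    i > 1/2 on a moved piece, so its positivity passes from x to y but the value of u i does not. *)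
Definition decodes (H : 'I_2 -> X -> R) n (u : 'I_n -> X -> R) :=
  forall x y, (forall g l, H l (act g x) = H l (act g y)) ->
    forall i, 3 / 4 <= u i x -> 1 / 2 < u i y.

(** A castle together with a piecewise translation moving its closed bases {u i >= 3/4} into [D];
    bundling them allows one to be chosen for each member of a sequence. *)
Record marked_castle (K : {fset G}) (eps : R) (D : set X) := MarkedCastle {
  mc_n : nat;
  mc_S : 'I_mc_n -> {fset G};
  mc_u : 'I_mc_n -> X -> R;
  mc_m : nat;
  mc_U : 'I_mc_m -> set X;
  mc_g : 'I_mc_m -> G;
  mc_soft : soft_castle act mc_S mc_u;
  mc_inv : forall i, invariant_shape K eps (mc_S i);
  mc_thin : thin act eps (remainder act mc_S mc_u);
  mc_open : forall j, open (mc_U j);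
  mc_cover : forall i x, 3 / 4 <= mc_u i x -> exists j, mc_U j x;
  mc_sub : forall j x, mc_U j x -> D (act (mc_g j) x);
  mc_disj : forall i j x y, mc_U i x -> mc_U j y ->
    act (mc_g i) x = act (mc_g j) y -> i = j /\ x = y }.

(** With all shapes of size at least N > 1/c, the bases have mass at most 1/N, below that of [D]. *)
Lemma marked_castle_exists K eps D : 0 < eps -> open D ->
  (exists2 c : R, 0 < c & mass_ge act c D) ->
  exists mc : marked_castle K eps D, True.
Proof.
move=> eps0 oD [c c0 cD].
pose N := (Num.truncn c^-1).+1.
have NR : c^-1 < N%:R by rewrite truncnS_gt.
have N0 : 0 < N%:R :> R by rewrite ltr0n.
have [n [S [u [SU inv NS thS]]]] := castle_ex K N eps0.
have [cu u01 S1 dS] := SU.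
pose A : set X := [set x | exists i, 3 / 4 <= u i x].
have cA : closed A.
  have -> : A = \bigcup_i [set x | 3 / 4 <= u i x].
    by apply/seteqP; split=> x [i]; exists i.
  apply: closed_bigcup; first exact: finite_finset.
  by move=> i _; exact: (closed_ge_cont (cu i)).
have lA : mass_le act N%:R^-1 A.
  apply: (castle_le act_action SU (Q := fun=> [fset 1%g]%fset)) => //.
  - by move=> i p; rewrite inE => /eqP->.
  - by move=> i; rewrite cardfs1 ler_pdivlMl// mulr1 ler_nat.
  - by move=> x [i ui]; exists i, 1%g; rewrite inE invg1 act1.
have NC : N%:R^-1 < c by rewrite -[ltRHS]invrK ltf_pV2 ?posrE ?invr_gt0.
have [m [U [g [oU AU UD dU]]]] := comparison_mass act_action cmp cA oD lA cD NC.
unshelve eexists (@MarkedCastle K eps D n S u m U g _ _ _ _ _ _ _) => //.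
by move=> i x ui; apply: AU; exists i.
Qed.

(** The markers of a whole sequence of castles live in disjoint regions of [E], so they form one
    countable disjoint family, which a single pair [H] codes. The sequence is cofinal: every (K,
    eps) is met by some castle in it. *)
Lemma decodable_castles (c : R) : countable [set: G] ->
  open E -> 0 < c -> mass_ge act c E ->
  exists H : 'I_2 -> X -> R, [/\ forall l, continuous (H l),
    forall l x, 0 <= H l x <= 1, forall l x, 0 < H l x -> E x
    & forall (K : {fset G}) (eps : R), 0 < eps ->
      exists n (S : 'I_n -> {fset G}) (u : 'I_n -> X -> R),
      [/\ soft_castle act S u, forall i, invariant_shape K eps (S i),
        thin act eps (remainder act S u) & decodes H u]].
Proof.
move=> cG oE c0 cE; have [D [oD DE dD mD]] := disjoint_open_seq oE c0 cE.
have [h hP] : exists h : nat -> G, forall g, exists k, h k = g.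
  have /countable_injP[f fI] := cG.
  have inv k : exists g, forall g', f g' = k -> g = g'.
    have [[g gk]|nex] := pselect (exists g, f g = k); last first.
      by exists 1%g => g' gk; exfalso; apply: nex; exists g'.
    by exists g => g' gk'; apply: fI; rewrite ?inE// gk.
  have [h hP] := choice inv.
  by exists h => g; exists (f g); exact: hP.
(* An initial part of an enumeration of the group, paired with the tolerance 1/(n + 1). *)
pose K n := (1%g |` [fset g in map h (iota 0 n)])%fset.
pose e n : R := n.+1%:R^-1.
have e0 n : 0 < e n by rewrite invr_gt0.
have mcex n : exists mc : marked_castle (K n) (e n) (D n), True.
  exact: marked_castle_exists.
pose mc n := projT1 (cid (mcex n)).
pose T : countType := {n : nat & ('I_(mc_m (mc n)) * 'I_(mc_n (mc n)))%type}.
(* For t = (n, (j, i)), the marker lives on the j-th moved piece of castle n, cut down to u i > 1/2,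
   so that its position also tells the tower i. *)
have coz (t : T) : exists w : X -> R, [/\ continuous w, forall x, 0 <= w x <= 1
    & forall x, (0 < w x) <-> (mc_U (tagged t).1 x /\ 1 / 2 < mc_u (tagged t).2 x)].
  have [] := @cozero R X (mc_U (tagged t).1 `&` [set x | 1 / 2 < mc_u (tagged t).2 x]).
    apply: openI; first exact: mc_open.
    apply: open_gt_cont; have [cu _ _ _] := mc_soft (mc (tag t)); exact: cu.
  by move=> w [cw w01 wP]; exists w; split.
have [w0 w0P] := choice coz.
pose gt (t : T) := mc_g (tagged t).1.
pose w t x := w0 t (act (gt t)^-1%g x).
have w_pos t x : 0 < w t x <-> (mc_U (tagged t).1 (act (gt t)^-1%g x) /\
    1 / 2 < mc_u (tagged t).2 (act (gt t)^-1%g x)).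
  by have [_ _] := w0P t; exact.
have wD t x : 0 < w t x -> D (tag t) x.
  by move=> /w_pos[/mc_sub + _]; rewrite actKV.
have [|||H [cH H01 HE Hcode]] := @disjoint_code R X T w.
- by move=> t; have [cw _ _] := w0P t; exact: (cont_act act_action cw).
- by move=> t x; have [_ w01 _] := w0P t; exact: w01.
- move=> s t x ws wt; have := dD _ _ _ (wD _ _ ws) (wD _ _ wt).
  have /w_pos[] := ws; have /w_pos[] := wt.
  case: s t {ws wt} => n [j i] [n' [j' i']] /=; rewrite /gt/= => U' u' U_ u_ nn.
  subst n'; have [|jj _] := mc_disj U_ U'; first by rewrite !actKV.
  subst j'; have [_ _ S1 dS] := mc_soft (mc n).
  have [||ii _] := dS i i' 1%g 1%g (act (mc_g j)^-1%g x) (S1 i) (S1 i').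
  - by rewrite invg1 act1//; lra.
  - by rewrite invg1 act1//; lra.
  - by rewrite ii.
exists H; split => //; first by move=> l x /HE[t /wD/DE].
move=> K0 eps eps0.
have [n [nK ne]] : exists n, (forall g, g \in K0 -> g \in K n) /\ e n <= eps.
  have [k kP] := choice hP.
  exists (\max_(g <- K0) (k g).+1 + (Num.truncn eps^-1))%N; split.
    move=> g gK; rewrite !inE; apply/orP; right; apply/mapP.
    exists (k g) => //; rewrite mem_iota add0n/=.
    by rewrite ltn_addr//; exact: (leq_bigmax_seq (F := fun g => (k g).+1)).
  rewrite /e -[leRHS]invrK lef_pV2 ?posrE ?invr_gt0//.
  apply: (le_trans (ltW (truncnS_gt _))).
  by rewrite ler_nat ltnS leq_addl.
have SU := mc_soft (mc n).
exists (mc_n (mc n)), (mc_S (m := mc n)), (mc_u (m := mc n)); split => //.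
- move=> i; have := mc_inv (m := mc n) i => /invariant_coreP inv.
  apply: (invariant_core_sub (K' := K n)) ne (inv _) => //; by rewrite !inE eqxx.
- by apply: thin_le ne _; exact: mc_thin.
move=> x y xy i ui; have [j Uj] := mc_cover ui.
pose t : T := existT _ n (j, i).
have := Hcode (act (mc_g j) x) (act (mc_g j) y) (fun l => xy _ l) t => wxy.
have wx : 0 < w t (act (mc_g j) x).
  by apply/w_pos; rewrite /gt/= actK//; split => //; lra.
rewrite wxy in wx; move/w_pos: wx => [_]; by rewrite /gt/= actK.
Qed.

End markers.
End decodable.

(** * Coding a tower *)

Section tower_coding.
Context (R : realType) (G : groupType) (X : metricType R) (act : G -> X -> X).
Hypothesis X_compact : compact [set: X].

Lemma size_le_counting (T : choiceType) (l : seq T) (D : set T) (b : R) :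
  uniq l -> (forall x, x \in l -> D x) -> (counting D <= b%:E)%E ->
  (size l)%:R <= b.
Proof.
move=> ul lD Db; rewrite -lee_fin; apply: le_trans Db.
apply: (@le_trans _ _ (counting [set` [fset x in l]%fset])).
  rewrite counting_fset lee_fin ler_nat; apply: uniq_leq_size => // x xl.
  by rewrite inE.
by apply: le_counting => x /=; rewrite inE; exact: lD.
Qed.

(** A partition of unity on a finite subcover; the order of [V] bounds the number of functions
    nonzero at a point, that is the number of vertices of the simplex containing its image in the
    nerve. *)
Lemma finite_nerve (V : set (set X)) (b : R) : open_cover V ->
  (forall x, (counting [set A | V A /\ A x] <= b%:E)%E) ->
  exists r (W : 'I_r -> set X) (theta : 'I_r -> X -> R),
    [/\ forall i, V (W i), forall i, W i !=set0,
        (forall i, continuous (theta i)) /\ (forall i x, 0 <= theta i x),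
        (forall i x, 0 < theta i x -> W i x) /\ (forall x, \sum_i theta i x = 1)
      & forall x, #|[set i | theta i x != 0%R]%SET|%:R <= b].
Proof.
move=> [oV cV] ordV.
pose f (A : set X) := if `[< V A >] then A else set0.
have [|x _|s [us sc]] := @finite_subcover X setT _ f X_compact.
- move=> A; rewrite /f; case: asboolP => [/oV//|_]; exact: open0.
- have [A VA Ax] : (\bigcup_(A in V) A) x by rewrite cV.
  by exists A => //; rewrite /f asboolT.
(* Distinct members make the count by indices a count by members, and nonempty ones provide the
   points attached to the vertices. *)
pose t := [seq A <- s | `[< V A /\ A !=set0 >]].
have ut : uniq t by exact: filter_uniq.
pose W (i : 'I_(size t)) := nth set0 t i.
have WP i : V (W i) /\ W i !=set0.
  have : W i \in t by apply: mem_nth.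
  by rewrite mem_filter => /andP[/asboolP].
have cW x : exists i, W i x.
  have [A As] := sc x I; rewrite /f; case: asboolP => // VA Ax.
  have At : A \in t by rewrite mem_filter As andbT; apply/asboolP; split => //; exists x.
  have it : (index A t < size t)%N by rewrite index_mem.
  exists (Ordinal it); by rewrite /W /= nth_index.
have cex i : exists u : X -> R, [/\ continuous u, forall x, 0 <= u x <= 1
    & forall x, (0 < u x) <-> W i x].
  by apply: cozero; apply: oV; have [] := WP i.
have [c cP] := choice cex.
have c0 i x : 0 <= c i x by have [_ /(_ x)/andP[]] := cP i.
have cc i : continuous (c i) by have [] := cP i.
pose m x := \sum_i c i x.
have m0 x : 0 < m x.
  have [i Wi] := cW x; rewrite /m (bigD1 i)//= ltr_pwDl ?sumr_ge0//.
  by have [_ _ /(_ x)[_]] := cP i; exact.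
have cm : continuous m by apply: cont_sum => i _; exact: cc.
exists (size t), W, (fun i x => c i x / m x); split.
- by move=> i; have [] := WP i.
- by move=> i; have [] := WP i.
- split=> [i|i x]; last by rewrite divr_ge0// ltW.
  by apply: contM; [exact: cc|apply: contV => // x; rewrite gt_eqF].
- split=> [i x|x]; last by rewrite -mulr_suml -/(m x) divff ?gt_eqF.
  by rewrite pmulr_lgt0 ?invr_gt0//; have [_ _ /(_ x)[]] := cP i.
move=> x; rewrite cardE.
rewrite -(size_map W); apply: size_le_counting (ordV x).
  rewrite map_inj_uniq ?enum_uniq// => i j /eqP.
  by rewrite nth_uniq// => /eqP/val_inj.
move=> _ /mapP[i + ->]; rewrite mem_enum inE => ci.
split; first by have [] := WP i.
have [_ _ /(_ x)[+ _]] := cP i; apply.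
rewrite lt_neqAle c0 andbT eq_sym; apply: contraNneq ci => ->.
by rewrite mul0r.
Qed.

(* The vectors attached to the nerve of V and to the values h j are in general
   position, so the code stays injective when the coordinates in two small
   sets Qv and Qw are erased. *)
Lemma tower_code (M : nat) (S : {fset G}) (fr : 'I_M -> X -> R) (J : finType)
    (h : J -> X -> R) (V : set (set X)) (b d eps q : R) :
  open_cover V -> (forall x, (counting [set A | V A /\ A x] <= b%:E)%E) ->
  (forall W x y s, V W -> W x -> W y -> s \in S ->
     mdist (act s x) (act s y) < eps /\
     forall k, `|fr k (act s x) - fr k (act s y)| <= d) ->
  0 < d -> (forall j, continuous (h j)) -> (forall j x, 0 <= h j x <= 1) ->
  2 * b + #|J|%:R <= M%:R * (#|` S|%:R - 2 * q) ->
  exists code : G -> 'I_M -> X -> R,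
    [/\ forall s k, continuous (code s k),
        forall s k x, s \in S -> `|code s k x - fr k (act s x)| <= 3 * d
      & forall v w (Qv Qw : {fset G}), #|` Qv|%:R <= q -> #|` Qw|%:R <= q ->
          (forall s k, s \in S -> s \notin Qv -> s \notin Qw ->
             code s k v = code s k w) ->
          (forall s, s \in S -> mdist (act s v) (act s w) < eps) /\
          (forall j, h j v = h j w)].
Proof.
move=> cV ordV Vd d0 ch h01 dims.
have [r [W [theta [VW W0 [cth th0] [thW th1] cardth]]]] := finite_nerve cV ordV.
have [p pW] := choice W0.
pose I := ('I_r + J)%type; pose N := (S * 'I_M)%type.
(* A vertex of the nerve aims at the values of [fr] over the tower of a point in its member, so that
   the code stays near [fr]; a parameter [h j] aims at 0. *)
pose target (i : I) (n : N) := if i is inl i0 then fr n.2 (act (val n.1) (p i0)) else 0.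
(* The parameters together contribute at most [d]; the nerve part contributes at most 2 [d], one
   from the oscillation of [fr] and one from the perturbation. *)
pose d' := d / (#|J|%:R + 1).
have J0 : 0 < #|J|%:R + 1 :> R by rewrite ltr_wpDl.
have d'0 : 0 < d' by rewrite divr_gt0.
have d0' := ltW d0.
have d'd : d' <= d by rewrite ler_pdivrMr// ler_peMr// lerDr.
have Jd' : #|J|%:R * d' <= d.
  by rewrite /d' mulrCA ler_piMr// ler_pdivrMr// mul1r lerDl.
have [a [a_near a_gen]] := general_position target d'0.
pose coef (i : I) x := match i with inl i0 => theta i0 x | inr j => h j x end.
have ccoef i : continuous (coef i) by case: i.
pose code (s : G) k x := if insub s is Some s' then \sum_i coef i x * a i (s', k) else 0.
exists code; split.
- move=> s k; rewrite /code; case: insubP => [s' _ _|_]; last exact: contC.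
  by apply: cont_sum => i _; apply: contM; [exact: ccoef|exact: contC].
- move=> s k x sS; rewrite /code; case: insubP => [s' _ ss|]; last by rewrite sS.
  rewrite big_sumType/= -ss.
  have -> : fr k (act (val s') x) = \sum_i theta i x * fr k (act (val s') x).
    by rewrite -mulr_suml th1 mul1r.
  rewrite addrAC -sumrB; apply: le_trans (ler_normD _ _) _.
  apply: (@le_trans _ _ (\sum_i theta i x * (2 * d) + \sum_(j : J) d')).
    apply: lerD; apply: le_trans (ler_norm_sum _ _ _) _; apply: ler_sum.
      move=> i _; rewrite -mulrBr normrM (ger0_norm (th0 _ _)).
      have [ti|ti] := ltP 0 (theta i x); last first.
        by rewrite (_ : theta i x = 0) ?mul0r//; apply/eqP; rewrite eq_le ti th0.
      rewrite ler_wpM2l//.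
      have := a_near (inl i) (s', k) => /=.
      have [_ /(_ k)] := Vd _ _ _ (val s') (VW i) (pW i) (thW _ _ ti) (fsvalP s').
      rewrite !ler_norml => /andP[? ?] /andP[? ?]; apply/andP; split; lra.
    move=> j _; have := a_near (inr j) (s', k); rewrite /= subr0 => aj.
    have /andP[hj0 hj1] := h01 j x.
    rewrite normrM (ger0_norm hj0); apply: le_trans aj.
    by rewrite ler_piMl.
  rewrite -mulr_suml th1 mul1r sumr_const -[d' *+ _]mulr_natl.
  by have := Jd'; lra.
move=> v w Qv Qw cQv cQw eqc.
pose T : {set N} := [set n : N | (val n.1 \notin Qv) && (val n.1 \notin Qw)]%SET.
have cT : M%:R * (#|` S|%:R - 2 * q) <= #|T|%:R.
  pose B : {set S} := [set s : S | (val s \notin Qv) && (val s \notin Qw)]%SET.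
  have -> : T = finset.setX B [set: 'I_M]%SET.
    by apply/setP => -[s k]; rewrite !inE/= andbT.
  rewrite cardsX cardsT card_ord mulnC natrM ler_wpM2l//.
  have SB : (#|` S| <= #|B| + #|` Qv| + #|` Qw|)%N.
    have -> : #|B| = #|` [fset s in S | (s \notin Qv) && (s \notin Qw)]%fset|.
      rewrite cardE; rewrite -(size_map val) cardfE cardE -(size_map val).
      apply/eqP; rewrite -uniq_size_uniq.
      - by rewrite map_inj_uniq ?enum_uniq//; exact: val_inj.
      - by rewrite map_inj_uniq ?enum_uniq//; exact: val_inj.
      move=> s; apply/mapP/mapP => -[s']; rewrite mem_enum.
        move=> _ ->; have := fsvalP s'; rewrite !inE => /andP[sS sQ].
        by exists [` sS]%fset => //; rewrite mem_enum inE.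
      rewrite inE => Hs ->.
      have sF : val s' \in [fset s in S | (s \notin Qv) && (s \notin Qw)]%fset.
        by rewrite in_fset inE/=; apply/andP; split; [exact: fsvalP|exact: Hs].
      by exists [` sF]%fset => //; rewrite mem_enum.
    apply: (@leq_trans
      #|` ([fset s in S | (s \notin Qv) && (s \notin Qw)] `|` Qv `|` Qw)%fset|).
      apply: fsubset_leq_card; apply/fsubsetP => s sS; rewrite !inE sS/=.
      by case: (s \in Qv) => //; case: (s \in Qw).
    apply: leq_trans (leq_card_fsetU _ _) _; rewrite leq_add2r.
    exact: leq_card_fsetU.
  move: SB; rewrite -(ler_nat R) !natrD => SB; lra.
pose c i := coef i v - coef i w.
(* The difference of the two coefficient vectors is supported on the two simplices and [J], at most
   2 [b] + |J| indices, and [T] has at least as many coordinates. Equal coefficients then put v and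
   w in a common member of [V]. *)
have c0 : forall i, c i = 0.
  apply: (a_gen c T).
    rewrite -(ler_nat R); apply: le_trans cT; apply: le_trans dims.
    pose Av := [set i | theta i v != 0%R]%SET; pose Aw := [set i | theta i w != 0%R]%SET.
    apply: (@le_trans _ _
      (#|(inl @: Av : {set I}) :|: (inl @: Aw) :|: (inr @: [set: J])|%SET%:R)).
      rewrite ler_nat; apply: subset_leq_card; apply/fintype.subsetP => -[i|j].
        rewrite !inE /c/= => ci; apply/orP; left; rewrite !mem_imset ?inE;
          do ?[by move=> ? ? []].
        have [tv|//] := eqVneq (theta i v) 0; have [tw|//] := eqVneq (theta i w) 0.
        by move: ci; rewrite tv tw subrr eqxx.
      by rewrite !inE => _; apply/orP; right; apply: imset_f; rewrite inE.
    apply: (@le_trans _ _ (#|Av| + #|Aw| + #|J|)%:R).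
      rewrite ler_nat; apply: leq_trans (leq_card_setU _ _) _; apply: leq_add.
        apply: leq_trans (leq_card_setU _ _) _.
        by apply: leq_add; exact: leq_imset_card.
      by apply: leq_trans (leq_imset_card _ _) _; rewrite cardsT.
    by rewrite !natrD; have := cardth v; have := cardth w; lra.
  move=> [s k]; rewrite inE/= => /andP[sv sw].
  have := eqc (val s) k (fsvalP s) sv sw; rewrite /code valK => e.
  transitivity (\sum_i coef i v * a i (s, k) - \sum_i coef i w * a i (s, k)).
    by rewrite -sumrB; apply: eq_bigr => i _; rewrite mulrBl.
  by rewrite e subrr.
have cE i : coef i v = coef i w by apply/eqP; rewrite -subr_eq0; apply/eqP; exact: c0.
split=> [s sS|j]; last exact: (cE (inr j)).
have [i ti] : exists i, 0 < theta i v.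
  apply: contrapT => /forallNP H; have := th1 v; rewrite big1 => [/eqP|i _].
    by rewrite eq_sym oner_eq0.
  by apply/eqP; rewrite eq_le th0 andbT leNgt; apply/negP.
have tw : 0 < theta i w by have := cE (inl i) => /= <-.
by have [] := Vd _ _ _ s (VW i) (thW _ _ ti) (thW _ _ tw) sS.
Qed.

End tower_coding.

(** * Separating functions and their transport into towers *)

Section separating.
Context (R : realType) (G : groupType) (X : metricType R) (act : G -> X -> X).
Hypothesis act_action : continuous_action act.
Hypothesis X_compact : compact [set: X].

Lemma cont_mdist (p : X) : continuous (fun x => mdist x p : R).
Proof.
by apply: lipschitz_cont => x y; rewrite addrC; exact: metric_triangle.
Qed.

(** Distances to a finite e-net, truncated at 1; as e < 1, a point close to the net sees its true
    distance there. *)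
Lemma separating_net (eps : R) : 0 < eps ->
  exists r (psi : 'I_r -> X -> R), [/\ forall k, continuous (psi k),
    forall k x, 0 <= psi k x <= 1
    & forall x y, (forall k, psi k x = psi k y) -> mdist x y < eps].
Proof.
move=> eps0; pose e := Num.min eps 1 / 3.
have e0 : 0 < e by rewrite divr_gt0// lt_min eps0 ltr01.
have e1 : e < 1 by rewrite ltr_pdivrMr// gt_min; apply/orP; right; lra.
have e2 : e + e < eps.
  have : e * 3 <= eps by rewrite /e divfK// ge_min lexx.
  lra.
have [|x _|s [_ sc]] := @finite_subcover X setT X
    (fun p => [set x : X | (mdist x p : R) < e]) X_compact.
- by move=> p; apply: open_lt_cont; exact: cont_mdist.
- by exists x => //=; rewrite mdistxx.
exists (size s), (fun k x => Num.min 1 (mdist x (tnth (in_tuple s) k))); split.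
- by move=> k; apply: cont_min; [exact: contC|exact: cont_mdist].
- by move=> k x; rewrite le_min ler01 mdist_ge0 ge_min lexx.
move=> x y psi_eq; have [p ps /= xp] := sc x I.
have /(tnthP (in_tuple s))[k pk] : p \in in_tuple s by [].
have := psi_eq k; rewrite -pk (min_r (ltW (lt_trans xp e1))) => xy.
have yp : mdist y p < e.
  rewrite ltNge; apply/negP => ey; move: xp; rewrite xy ltNge => /negP; apply.
  by rewrite le_min (ltW e1).
apply: le_lt_trans (metric_triangle x p y) _; apply: lt_trans e2.
by rewrite (metric_sym p y) ltrD.
Qed.

(** Two functions code the disjoint bumps [w j] on the moved pieces, and the others carry [w j]
    times the moved [psi k]. Where the bump is known and positive, division recovers [psi k]. *)
Lemma transport_code m (U : 'I_m -> set X) (g : 'I_m -> G) r (psi : 'I_r -> X -> R) :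
  (forall j, open (U j)) ->
  (forall i j x y, U i x -> U j y -> act (g i) x = act (g j) y -> i = j /\ x = y) ->
  (forall k, continuous (psi k)) -> (forall k x, 0 <= psi k x <= 1) ->
  exists h : 'I_2 + 'I_r -> X -> R, [/\ forall l, continuous (h l),
    forall l x, 0 <= h l x <= 1
    & forall j x y, U j x -> (forall l, h l (act (g j) x) = h l (act (g j) y)) ->
      forall k, psi k x = psi k y].
Proof.
move=> oU dU cpsi psi01.
have cex j := cozero (oU j); have [c cP] := choice cex.
pose w j x := c j (act (g j)^-1%g x).
have w01 j x : 0 <= w j x <= 1 by have [_ c01 _] := cP j; exact: c01.
have cw j : continuous (w j) by have [cc _ _] := cP j; exact: (cont_act act_action cc).
have w0 j x : 0 <= w j x by have /andP[] := w01 j x.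
have dw i j x : 0 < w i x -> 0 < w j x -> i = j.
  have [_ _ ci] := cP i; have [_ _ cj] := cP j.
  by move=> /ci Ui /cj Uj; have [|//] := dU _ _ _ _ Ui Uj; rewrite !actKV.
have wz i j x : 0 < w j x -> i != j -> w i x = 0.
  move=> wj ij; apply/eqP; rewrite eq_le w0 andbT leNgt; apply/negP => wi.
  by rewrite (dw _ _ _ wi wj) eqxx in ij.
have [H [cH H01 _ Hw]] := disjoint_code cw w01 dw.
pose f k x := \sum_j w j x * psi k (act (g j)^-1%g x).
have fE k j x : 0 < w j x -> f k x = w j x * psi k (act (g j)^-1%g x).
  move=> wj; rewrite /f (bigD1 j)//= big1 ?addr0// => i ij.
  by rewrite (wz i j)// mul0r.
pose h (l : 'I_2 + 'I_r) := match l with inl a => H a | inr k => f k end.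
exists h; split.
- move=> [a|k] /=; first exact: cH.
  by apply: cont_sum => j _; apply: contM => //; exact: (cont_act act_action (cpsi k)).
- move=> [a|k] x /=; first exact: H01.
  have [[j wj]|n] := pselect (exists j, 0 < w j x).
    rewrite (fE _ j)//; have /andP[p0 p1] := psi01 k (act (g j)^-1%g x).
    by have /andP[_ w1] := w01 j x; rewrite mulr_ge0//= mulr_ile1.
  rewrite /f big1 ?lexx ?ler01// => j _.
  rewrite (_ : w j x = 0) ?mul0r//; apply/eqP; rewrite eq_le w0 andbT leNgt.
  by apply/negP => wj; apply: n; exists j.
move=> j x y Ux hxy k.
have wx : 0 < w j (act (g j) x).
  by rewrite /w actK//; have [_ _ cj] := cP j; apply/cj.
have wxy : w j (act (g j) x) = w j (act (g j) y) by apply: Hw => a; exact: (hxy (inl a)).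
have := hxy (inr k); rewrite /= (fE _ j)// (fE _ j) -?wxy// !actK// => e.
by have /mulfI := lt0r_neq0 wx; exact.
Qed.

End separating.

(** * Freezing the slots *)

Section assembly.
Context (R : realType) (G : groupType) (X : metricType R) (act : G -> X -> X).
Hypothesis act_action : continuous_action act.
Context (beta : X -> R) (e : 'I_3 -> G) (H : 'I_2 -> X -> R) (m : nat).
Hypothesis cbeta : continuous beta.
Hypothesis beta01 : forall x, 0 <= beta x <= 1.
Hypothesis e0 : e 0 = 1%g.
Hypothesis dbeta : forall l l' x, 0 < beta (act (e l)^-1%g x) ->
  0 < beta (act (e l')^-1%g x) -> l = l'.
Hypothesis cH : forall l, continuous (H l).
Hypothesis H01 : forall l x, 0 <= H l x <= 1.
Hypothesis Hbeta : forall l x, 0 < H l x -> 1 / 2 < beta x.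

Definition slot (l : 'I_3) (x : X) : R := Num.min 1 (2 * beta (act (e l)^-1%g x)).

(** Slot 0 shows a value above 1/2 exactly when [beta] does; the components of [H] are halved so
    that the other two slots never exceed 1/2. *)
Definition slot_value (l : 'I_3) (x : X) : R :=
  if unlift 0 l is Some j then H j x / 2 else Num.max (1 / 2) (beta x).

(* Coordinate 0 is overwritten on the slots e l {beta > 1/2}: it exceeds 1/2
   exactly on {beta > 1/2}, and the two other slots carry H. *)
Definition assemble (fr : 'I_m.+1 -> X -> R) (k : 'I_m.+1) (x : X) : R :=
  if k == 0 then (1 - \sum_l slot l x) * fr k x +
    \sum_l slot l x * slot_value l (act (e l)^-1%g x)
  else fr k x.

Lemma slot_ge0 l x : 0 <= slot l x.
Proof. by rewrite le_min ler01 mulr_ge0//; have /andP[] := beta01 (act (e l)^-1%g x). Qed.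

Lemma slot_le1 l x : slot l x <= 1. Proof. by rewrite ge_min lexx. Qed.

Lemma slot_gt0 l x : 0 < slot l x -> 0 < beta (act (e l)^-1%g x).
Proof. by rewrite lt_min ltr01 pmulr_rgt0. Qed.

Lemma slot_cases x :
  (forall l, slot l x = 0) \/
  exists2 l, 0 < slot l x & forall l', l' != l -> slot l' x = 0.
Proof.
have z l : ~ 0 < slot l x -> slot l x = 0.
  by move=> /negP; rewrite -leNgt => s0; apply/eqP; rewrite eq_le s0 slot_ge0.
have [[l sl]|n] := pselect (exists l, 0 < slot l x); [right|left].
  exists l => // l' ne; apply: z => sl'.
  by rewrite (dbeta (slot_gt0 sl') (slot_gt0 sl)) eqxx in ne.
by move=> l; apply: z => sl; apply: n; exists l.
Qed.

Lemma sum_slot_le1 x : 0 <= 1 - \sum_l slot l x <= 1.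
Proof.
rewrite subr_ge0 gerBl sumr_ge0 ?andbT//; last by move=> l _; exact: slot_ge0.
have [z|[l _ z]] := slot_cases x; first by rewrite big1 ?ler01// => l _; exact: z.
by rewrite (bigD1 l)//= big1 ?addr0 ?slot_le1// => l' ne; exact: z.
Qed.

Lemma assemble_off fr k x : (forall l, slot l x = 0) -> assemble fr k x = fr k x.
Proof.
move=> z; rewrite /assemble; case: eqP => // ->.
by rewrite !big1 ?subr0 ?mul1r ?addr0// => l _; rewrite z// mul0r.
Qed.

Lemma assemble_on fr x l : (forall l', l' != l -> slot l' x = 0) ->
  assemble fr 0 x = (1 - slot l x) * fr 0 x +
    slot l x * slot_value l (act (e l)^-1%g x).
Proof.
move=> z; rewrite /assemble eqxx (bigD1 l)//= big1 ?addr0; last by move=> l' /z.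
by rewrite (bigD1 l)//= big1 ?addr0// => l' /z->; rewrite mul0r.
Qed.

Lemma slot_value_cont l : continuous (slot_value l).
Proof.
rewrite /slot_value; case: unliftP => [j _|_].
  by apply: contM; [exact: cH|exact: contC].
by apply: cont_max => //; exact: contC.
Qed.

Lemma slot_value01 l x : 0 <= slot_value l x <= 1.
Proof.
rewrite /slot_value; case: unliftP => [j _|_].
  by have := H01 j x; lra.
have /andP[b0 b1] := beta01 x; rewrite le_max b0 orbT ge_max b1 andbT; lra.
Qed.

Lemma assemble_cont fr k : (forall k, continuous (fr k)) -> continuous (assemble fr k).
Proof.
move=> cfr; have cs l : continuous (slot l).
  apply: cont_min; first exact: contC.
  by apply: contM; [exact: contC|exact: (cont_act act_action cbeta)].
rewrite /assemble; case: eqP => // _; apply: contD.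
  apply: contM => //; apply: contB; first exact: contC.
  by apply: cont_sum => l _.
apply: cont_sum => l _; apply: contM => //.
exact: (cont_act act_action (@slot_value_cont l)).
Qed.

Lemma assemble01 fr k x : (forall k x, 0 <= fr k x <= 1 / 2) -> 0 <= assemble fr k x <= 1.
Proof.
move=> fr01; have := fr01 k x.
have [->|k0] := eqVneq k 0; last by rewrite /assemble (negPf k0); lra.
have [z|[l _ z]] := slot_cases x; first by rewrite assemble_off//; lra.
rewrite (assemble_on _ z) => /andP[f0 f1].
have := slot_value01 l (act (e l)^-1%g x); have := slot_le1 l x; have := slot_ge0 l x.
by move=> ? ? /andP[? ?]; apply/andP; split; nra.
Qed.

Lemma assemble_lip fr fr' k x : `|assemble fr k x - assemble fr' k x| <= `|fr k x - fr' k x|.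
Proof.
rewrite /assemble; case: eqP => // _.
rewrite opprD addrACA subrr addr0 -mulrBr normrM.
by have /andP[s0 s1] := sum_slot_le1 x; rewrite (ger0_norm s0) ler_piMl.
Qed.

Lemma slot1 l x : 1 / 2 < beta x -> slot l (act (e l) x) = 1.
Proof. by move=> bx; rewrite /slot actK// min_l//; lra. Qed.

Lemma slot1_other l l' x : 1 / 2 < beta x -> l' != l -> slot l' (act (e l) x) = 0.
Proof.
move=> bx ne; have [z|[l0 s0 z]] := slot_cases (act (e l) x); first exact: z.
have [e1|ne1] := eqVneq l l0; last first.
  by have := slot1 l bx; rewrite z// => /eqP; rewrite eq_sym oner_eq0.
by apply: z; rewrite -e1.
Qed.

Lemma assemble_slot fr l x : 1 / 2 < beta x ->
  assemble fr 0 (act (e l) x) = slot_value l x.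
Proof.
move=> bx; rewrite (assemble_on _ (fun l' => slot1_other bx (l' := l'))).
by rewrite slot1// subrr mul0r add0r mul1r actK.
Qed.

Lemma assemble_gt fr x : (forall k x, 0 <= fr k x <= 1 / 2) ->
  1 / 2 < assemble fr 0 x <-> 1 / 2 < beta x.
Proof.
move=> fr01; split=> [|bx]; last first.
  have := assemble_slot fr 0 bx; rewrite e0 act1// => ->.
  by rewrite /slot_value unlift_none lt_max bx orbT.
have := fr01 0 x.
have [z|[l _ z]] := slot_cases x; first by rewrite assemble_off//; lra.
rewrite (assemble_on _ z) => /andP[f0 f1].
have := slot_le1 l x; have := slot_ge0 l x.
have [->|ne] := eqVneq l 0.
  rewrite e0 invg1 act1// /slot_value unlift_none => s0 s1.
  rewrite ltNge => /negP; rewrite ltNge => H1; apply/negP => bx; apply: H1.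
  by rewrite max_l//; nra.
have : slot_value l (act (e l)^-1%g x) <= 1 / 2.
  rewrite /slot_value; case: unliftP => [j _|l0]; last by rewrite l0 eqxx in ne.
  by have := H01 j (act (e l)^-1%g x); lra.
move=> v1 s0 s1 H1; exfalso; nra.
Qed.

(** Coordinate 0 shows at which g both orbits meet {beta > 1/2}. There the slots hold [H]
    undisturbed, and elsewhere [H] vanishes. *)
Lemma assemble_decodes fr x y : (forall k x, 0 <= fr k x <= 1 / 2) ->
  (forall g k, assemble fr k (act g x) = assemble fr k (act g y)) ->
  forall g j, H j (act g x) = H j (act g y).
Proof.
move=> fr01 xy g j.
have H0 z : ~ 1 / 2 < beta z -> H j z = 0.
  move=> nb; apply/eqP; rewrite eq_le; have /andP[-> _] := H01 j z.
  by rewrite andbT leNgt; apply/negP => /Hbeta.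
have bxy : 1 / 2 < beta (act g x) <-> 1 / 2 < beta (act g y).
  by rewrite -(assemble_gt _ fr01) xy; exact: assemble_gt.
have [bx|nbx] := pselect (1 / 2 < beta (act g x)); last first.
  by rewrite H0// H0// => /bxy.
have by_ := bxy.1 bx.
have := xy (e (lift 0 j) * g)%g 0; rewrite !actM// !assemble_slot//.
by rewrite /slot_value liftK => h2; lra.
Qed.

End assembly.

(** * Perturbation to an eps-embedding *)

Section perturbation.
Context (R : realType) (G : groupType) (X : metricType R) (act : G -> X -> X).
Hypothesis act_action : continuous_action act.
Hypothesis X_compact : compact [set: X].
Hypothesis cmp : has_comparison R act.
Hypothesis G_infinite : infinite_set [set: G].

(** The weight min 1 (2 u) interpolates between [fr] and the code of the tower, and reaches 1
    already at u = 1/2, the threshold that decoding guarantees. *)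
Lemma paste_towers n (S : 'I_n -> {fset G}) (u : 'I_n -> X -> R) (m : nat)
    (fr : 'I_m -> X -> R) (code : 'I_n -> G -> 'I_m -> X -> R) (d : R) :
  soft_castle act S u -> (forall k, continuous (fr k)) ->
  (forall i s k, continuous (code i s k)) ->
  (forall i s k x, s \in S i -> `|code i s k x - fr k (act s x)| <= d) -> 0 <= d ->
  exists fr' : 'I_m -> X -> R, [/\ forall k, continuous (fr' k),
    forall k x, `|fr' k x - fr k x| <= d
    & forall i s k x, s \in S i -> 1 / 2 <= u i x -> fr' k (act s x) = code i s k x].
Proof.
move=> SU cfr ccode near_code d0; have [cu u01 S1 dS] := SU.
have u0 i x : 0 <= u i x by have /andP[] := u01 i x.
pose phi i x := Num.min 1 (2 * u i x).
have phi0 i x : 0 <= phi i x by rewrite le_min ler01 mulr_ge0.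
have phi1 i x : phi i x <= 1 by rewrite ge_min lexx.
have phi_gt0 i x : 0 < phi i x -> 0 < u i x by rewrite lt_min ltr01 pmulr_rgt0.
pose term (p : 'I_n * G) k x := phi p.1 (act p.2^-1%g x) *
  (code p.1 p.2 k (act p.2^-1%g x) - fr k x).
pose fr' k x := fr k x + \sum_(p <- levels S) term p k x.
have fr'E i s k x : s \in S i -> 0 < u i (act s^-1%g x) ->
    fr' k x = fr k x + term (i, s) k x.
  move=> sS ui; rewrite /fr' (bigD1_seq (i, s)) ?uniq_levels ?mem_levels//=.
  rewrite big1_seq ?addr0// => -[j t] /andP[ne]; rewrite mem_levels => tS.
  rewrite /term/= (_ : phi j _ = 0) ?mul0r//; apply/eqP; rewrite eq_le phi0 andbT leNgt.
  apply/negP => /phi_gt0 uj; have [e1 e2] := dS _ _ _ _ _ sS tS ui uj.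
  by rewrite e1 e2 eqxx in ne.
exists fr'; split.
- move=> k; apply: contD => //; apply: cont_sum => -[i s] _; rewrite /term/=.
  apply: contM; last by apply: contB => //; exact: (cont_act act_action (@ccode i s k)).
  apply: (cont_act act_action (f := phi i)); apply: cont_min; first exact: contC.
  by apply: contM => //; exact: contC.
- move=> k x; have [[i [s [sS ui]]]|none] :=
    pselect (exists i s, s \in S i /\ 0 < u i (act s^-1%g x)).
    rewrite (fr'E i s)// addrC addKr /term/= normrM (ger0_norm (phi0 _ _)).
    have := near_code i s k (act s^-1%g x) sS; rewrite actKV// => h.
    by apply: le_trans h; rewrite ler_piMl.
  rewrite /fr' big1_seq; first by rewrite addr0 subrr normr0.
  move=> [i s] /andP[_]; rewrite mem_levels => sS.
  rewrite /term/= (_ : phi i _ = 0) ?mul0r//; apply/eqP; rewrite eq_le phi0 andbT leNgt.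
  by apply/negP => /phi_gt0 ui; apply: none; exists i, s.
move=> i s k x sS ui.
have ui' : 0 < u i (act s^-1%g (act s x)) by rewrite actK//; lra.
rewrite (fr'E _ _ _ _ sS ui').
by rewrite /term/= actK// /phi min_l ?mul1r; [rewrite addrC subrK|lra].
Qed.

(** Mean dimension is applied to the cover by open sets of diameter below [eps] on which [fr] varies
    by at most [d]. A set inside s^-1 O for all s in [S] is moved by each s into such an O. *)
Lemma mdim_nerve (m : nat) (gamma eps d : R) (fr : 'I_m -> X -> R) :
  (forall U : set (set X), open_cover U ->
    exists (F : {fset G}) (eps : R), 0 < eps /\
    forall S : {fset G}, invariant_shape F eps S ->
    (cover_dim R (join_covers S (fun g => translate_cover act g^-1%g U)) <
     ((m%:R / 2 - gamma) * #|` S|%:R)%:E)%E) ->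
  0 < eps -> 0 < d -> (forall k, continuous (fr k)) ->
  exists (F : {fset G}) (eta : R), 0 < eta /\
    forall S : {fset G}, invariant_shape F eta S -> exists V : set (set X),
      [/\ open_cover V,
        forall x, (counting [set A | V A /\ A x] <= ((m%:R / 2 - gamma) * #|` S|%:R)%:E)%E
      & forall W x y s, V W -> W x -> W y -> s \in S ->
          mdist (act s x) (act s y) < eps /\
          forall k, `|fr k (act s x) - fr k (act s y)| <= d].
Proof.
move=> mdim eps0 d0 cfr.
pose U : set (set X) := [set O | open O /\ forall x y, O x -> O y ->
  mdist x y < eps /\ forall k, `|fr k x - fr k y| <= d].
have cU : open_cover U.
  split; first by move=> O [].
  rewrite -subTset => x _.
  pose D y := \sum_k `|fr k y - fr k x|.
  have Dk y k : `|fr k y - fr k x| <= D y.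
    by rewrite /D (bigD1 k)//= lerDl sumr_ge0.
  exists ([set y | mdist y x < eps / 2] `&` [set y | D y < d / 2]); last first.
    split=> /=; first by rewrite mdistxx; lra.
    by rewrite /D big1 => [|k _]; rewrite ?subrr ?normr0//; lra.
  split.
    apply: openI; first by apply: open_lt_cont; exact: cont_mdist.
    apply: open_lt_cont; apply: cont_sum => k _; apply: cont_norm.
    by apply: contB => //; exact: contC.
  move=> y z [/= yx yk] [/= zx zk]; split.
    by have := metric_triangle y x z; rewrite (metric_sym x z); lra.
  move=> k; have := le_lt_trans (Dk y k) yk; have := le_lt_trans (Dk z k) zk.
  rewrite !ltr_norml ler_norml.
  by move=> /andP[? ?] /andP[? ?]; apply/andP; split; lra.
have [F [eta [eta0 H]]] := mdim U cU; exists F, eta; split => // S invS.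
have /ereal_inf_lt[_ [V [cV rV] <-] Vlt] := H S invS.
exists V; split => //.
- move=> x; apply: le_trans (ltW Vlt); apply: ereal_sup_ubound; right.
  by exists x.
- move=> W x y s VW Wx Wy sS.
  have [_ [A [AU ->]] WA] := rV _ VW.
  have [ O [oO HO] AO] := AU s sS.
  have inO z : W z -> O (act s z).
    move=> Wz; have := WA _ Wz s sS; rewrite -AO => -[z1 Oz1 <-].
    by rewrite actKV.
  exact: HO (inO _ Wx) (inO _ Wy).
Qed.

Lemma take_shape (S : {fset G}) (k : nat) : (k <= #|` S|)%N ->
  exists P : {fset G}, (forall p, p \in P -> p \in S) /\ #|` P| = k.
Proof.
move=> kS; exists [fset x in take k (enum_fset S)]%fset; split.
  by move=> p; rewrite inE => /mem_take.
apply/eqP; rewrite eqn_leq.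
have sz : size (take k (enum_fset S)) = k by rewrite size_takel.
have ut : uniq (take k (enum_fset S)) by apply: take_uniq; exact: fset_uniq.
rewrite -[X in (_ <= X)%N && _]sz -[X in _ && (X <= _)%N]sz; apply/andP; split.
  by apply: uniq_leq_size => [|x]; [exact: fset_uniq|rewrite inE].
by apply: uniq_leq_size => // x xt; rewrite inE.
Qed.

Context (beta : X -> R) (e : 'I_3 -> G) (H : 'I_2 -> X -> R) (m : nat).
Hypothesis cbeta : continuous beta.
Hypothesis beta01 : forall x, 0 <= beta x <= 1.
Hypothesis e0 : e 0 = 1%g.
Hypothesis dbeta : forall l l' x, 0 < beta (act (e l)^-1%g x) ->
  0 < beta (act (e l')^-1%g x) -> l = l'.
Hypothesis cH : forall l, continuous (H l).
Hypothesis H01 : forall l x, 0 <= H l x <= 1.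
Hypothesis Hbeta : forall l x, 0 < H l x -> 1 / 2 < beta x.
Hypothesis castles : forall (K : {fset G}) (eps : R), 0 < eps ->
  exists n (S : 'I_n -> {fset G}) (u : 'I_n -> X -> R),
    [/\ soft_castle act S u, forall i, invariant_shape K eps (S i),
      thin act eps (remainder act S u) & decodes act H u].
Context (gamma : R).
Hypothesis gamma01 : 0 < gamma <= 1.
Hypothesis visits : exists K (eps : R), [/\ 0 < eps, 1%g \in K & forall T : {fset G},
  (1 - eps) * #|` T|%:R < #|` shape_core K T|%:R -> forall v,
  #|` [fset s in T | [exists l, 0 < beta (act (e l)^-1%g (act s v))]]%fset|%:R
    <= gamma / (2 * m.+1%:R) * #|` T|%:R].
Hypothesis mdim : forall U : set (set X), open_cover U ->
  exists (F : {fset G}) (eps : R), 0 < eps /\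
  forall S : {fset G}, invariant_shape F eps S ->
  (cover_dim R (join_covers S (fun g => translate_cover act g^-1%g U)) <
   ((m.+1%:R / 2 - gamma) * #|` S|%:R)%:E)%E.

Let asm := @assemble R G X act beta e H m.

(** Agreement of two points along their orbits is first used to decode the castle, then to compare
    codes on a tower. A point in the towers is located directly by the nerve; a point of the
    remainder is located through the free parameters of the tower it is moved to. The margin [d]
    keeps the new map in [0, 1/2]. *)
Lemma perturb_interior (fr : 'I_m.+1 -> X -> R) (d eps : R) :
  (forall k, continuous (fr k)) -> 0 < d -> 0 < eps ->
  (forall k x, d <= fr k x <= 1 / 2 - d) ->
  exists fr' : 'I_m.+1 -> X -> R, [/\ forall k, continuous (fr' k),
    forall k x, 0 <= fr' k x <= 1 / 2, forall k x, `|fr' k x - fr k x| <= d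
    & forall x y, (forall g k, asm fr' k (act g x) = asm fr' k (act g y)) ->
        mdist x y < eps].
Proof.
move=> cfr d0 eps0 frd.
have /andP[gam0 gam1] := gamma01.
have d3 : 0 < d / 3 by rewrite divr_gt0.
have [F [eta1 [eta10 nerve]]] := mdim_nerve mdim eps0 d3 cfr.
have [K1 [eta2 [eta20 K1_1 vis]]] := visits.
have [r [psi [cpsi psi01 psi_sep]]] := separating_net X_compact eps0.
pose L : R := (r + 2)%:R.
have L1 : 1 <= L by rewrite /L ler1n addn2.
have L0 : 0 < L by apply: lt_le_trans L1.
(* The levels reserved for parameters have density at least gamma / (2L) (1 - [eta]), with L = r + 2
   functions to record; gamma / (8L) is safely below that. *)
pose eta := Num.min (Num.min eta1 eta2) (gamma / (8 * L)).
have gL : 0 < gamma / (8 * L) by rewrite divr_gt0// mulr_gt0.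
have eta0 : 0 < eta by rewrite !lt_min eta10 eta20.
have etale1 : eta <= eta1 by rewrite !ge_min lexx.
have etale2 : eta <= eta2 by rewrite !ge_min lexx orbT.
have etale3 : eta <= gamma / (8 * L) by rewrite ge_min lexx orbT.
(* Shapes this large have gamma |S| / L >= 1, so rounding it down to |P| loses at most half. *)
pose N := (Num.truncn (L / gamma)).+1.
have [B _ NB] := infinite_set_fset N G_infinite.
pose K := (F `|` K1 `|` B)%fset.
have K_1 : 1%g \in K by rewrite !inE K1_1 orbT.
have [n [S [u [SU inv thZ dec]]]] := castles K eta0.
have [cu u01 S1 dS] := SU.
have invc i := invariant_coreP K_1 (inv i).
have eta1' : eta <= 1.
  apply: (le_trans etale3); rewrite ler_pdivrMr ?mulr_gt0// mul1r.
  by apply: (le_trans gam1); lra.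
have invF i : invariant_shape F eta1 (S i).
  by apply: invariant_core_sub etale1 (invc i) => // g gF; rewrite !inE gF.
have invK1 i : (1 - eta2) * #|` S i|%:R < #|` shape_core K1 (S i)|%:R.
  apply: (@le_lt_trans _ _ ((1 - eta) * #|` S i|%:R)).
    by rewrite ler_wpM2r// lerB.
  apply: (lt_le_trans (invc i)); rewrite ler_nat; apply: shape_core_mono => g gK.
  by rewrite !inE gK orbT.
have NS i : (N <= #|` S i|)%N.
  apply: leq_trans (card_le_core (K := K) (S := S i) _).
    apply: (leq_trans NB); apply: fsubset_leq_card; apply/fsubsetP => g gB.
    by rewrite !inE gB orbT.
  rewrite -(ltr0n R); apply: le_lt_trans (invc i).
  by rewrite mulr_ge0// subr_ge0.
have SL i : L / gamma <= #|` S i|%:R.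
  by apply: (le_trans (ltW (truncnS_gt _))); rewrite ler_nat.
have Pex i : exists P : {fset G}, [/\ forall p, p \in P -> p \in S i,
    #|` P|%:R * L <= gamma * #|` S i|%:R &
    gamma / (2 * L) * #|` S i|%:R <= #|` P|%:R].
  pose y := gamma * #|` S i|%:R / L.
  have y1 : 1 <= y.
    rewrite /y ler_pdivlMr// mul1r; have := SL i.
    by rewrite ler_pdivrMr// mulrC.
  have yS : y <= #|` S i|%:R.
    rewrite /y ler_pdivrMr// [leRHS]mulrC; apply: ler_pM => //; first exact: ltW.
    exact: (le_trans gam1).
  have y0 : 0 <= y by apply: le_trans y1.
  have /andP[t1 t2] := truncn_itv y0.
  have t3 : 1 <= (Num.truncn y)%:R :> R.
    by rewrite ler1n -ltnS -(ltr_nat R); apply: le_lt_trans t2.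
  have [|P [PS cP]] := @take_shape (S i) (Num.truncn y).
    by rewrite -(ler_nat R); exact: le_trans t1 yS.
  exists P; split => //; rewrite cP.
    by rewrite -ler_pdivlMr//.
  have -> : gamma / (2 * L) * #|` S i|%:R = y / 2.
    by rewrite /y invfM; lra.
  by move: t2; rewrite -natr1; lra.
have [P PP] := choice Pex.
pose D : set X := \bigcup_(p in [set p : 'I_n * G | p.2 \in P p.1])
  [set x | 3 / 4 < u p.1 (act p.2^-1%g x)].
have oD : open D.
  apply: bigcup_open => -[i p] _.
  exact: (open_gt_cont _ (cont_act act_action (g := p^-1%g) (cu i))).
pose kap := gamma / (2 * L).
have kap0 : 0 <= kap by rewrite divr_ge0 ?mulr_ge0// ltW.
have gD : mass_ge act (kap * (1 - eta)) D.
  apply: (castle_ge act_action SU (P := P)) => //; first exact: ltW.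
  - by move=> i p; have [PS _ _] := PP i; exact: PS.
  - by move=> i; have [_ _ c] := PP i.
  - by move=> i p x pP ux; exists (i, p).
have cZ := closed_remainder act_action SU.
have lZ := thin_mass act_action (ltW eta0) cZ thZ.
have ltZD : eta < kap * (1 - eta).
  have k4 : kap = 4 * (gamma / (8 * L)) by rewrite /kap !invfM; lra.
  have g8 : gamma / (8 * L) <= 1 / 8.
    rewrite ler_pdivrMr ?mulr_gt0//; lra.
  by rewrite k4; nra.
have [nU [U [g [oU ZU UD dU]]]] := comparison_mass act_action cmp cZ oD lZ gD ltZD.
have [h [ch h01 h_psi]] := transport_code act_action oU dU cpsi psi01.
(* Twice this, over m + 1 coordinates, is gamma |S|: exactly what remains after the two simplices, M
   |S| - 2 gamma |S|, and the parameters, at most gamma |S|. *)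
pose q i := gamma / (2 * m.+1%:R) * #|` S i|%:R.
pose J i := (P i * ('I_2 + 'I_r))%type.
pose hJ i (j : J i) x := h j.2 (act (val j.1) x).
have code_ex i : exists code : G -> 'I_m.+1 -> X -> R,
    [/\ forall s k, continuous (code s k),
        forall s k x, s \in S i -> `|code s k x - fr k (act s x)| <= d
      & forall v w (Qv Qw : {fset G}), #|` Qv|%:R <= q i -> #|` Qw|%:R <= q i ->
          (forall s k, s \in S i -> s \notin Qv -> s \notin Qw ->
             code s k v = code s k w) ->
          (forall s, s \in S i -> mdist (act s v) (act s w) < eps) /\
          (forall p l, p \in P i -> h l (act p v) = h l (act p w))].
  have [V [cV ordV Vd]] := nerve _ (invF i).
  have [|||code [c1 c2 c3]] := @tower_code R G X act X_compact m.+1 (S i) fr (J i) (hJ i) V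
    _ (d / 3) eps (q i) cV ordV Vd d3.
  - by move=> j; exact: (cont_act act_action (ch j.2)).
  - by move=> j x; exact: h01.
  - have [_ PL _] := PP i.
    have -> : #|{: J i}|%:R = #|` P i|%:R * L.
      by rewrite card_prod card_sum !card_ord -cardfE natrM addnC.
    have -> : m.+1%:R * (#|` S i|%:R - 2 * q i) = m.+1%:R * #|` S i|%:R - gamma * #|` S i|%:R.
      rewrite mulrBr; congr (_ - _); rewrite /q.
      have m0 : m.+1%:R != 0 :> R by rewrite pnatr_eq0.
      rewrite invfM !mulrA; have := mulfV m0; set z := m.+1%:R^-1; set M := m.+1%:R => Mz.
      have -> : M * 2 * gamma * 2^-1 * z * #|` S i|%:R = (M * z) * gamma * #|` S i|%:R by lra.
      by rewrite Mz mul1r.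
    by rewrite mulrBl; lra.
  exists code; split => //.
    by move=> s k x sS; have := c2 s k x sS; rewrite mulrC divfK.
  move=> v w Qv Qw cv cw eqc; have [h1 h2] := c3 _ _ _ _ cv cw eqc.
  split => // p l pP; exact: (h2 ([` pP]%fset, l)).
have [code codeP] := choice code_ex.
have [|||fr' [cfr' fr'_near fr'_code]] := @paste_towers n S u m.+1 fr code d SU cfr.
- by move=> i s k; have [c1 _ _] := codeP i; exact: c1.
- by move=> i s k x; have [_ c2 _] := codeP i; exact: c2.
- exact: ltW.
have fr'01 k x : 0 <= fr' k x <= 1 / 2.
  have := fr'_near k x; have /andP[f1 f2] := frd k x; rewrite ler_norml => /andP[? ?].
  by apply/andP; split; lra.
exists fr'; split => // x y xy.
have Hxy := assemble_decodes act_action beta01 e0 dbeta H01 Hbeta fr'01 xy.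
(* Decoding puts both base points where u i >= 1/2, so [fr'] is the code at both. Positions visiting
   a slot of either point are erased; at the others [asm fr'] is [fr']. *)
have tower g0 i : 3 / 4 < u i (act g0 x) ->
    (forall s, s \in S i -> mdist (act (s * g0)%g x) (act (s * g0)%g y) < eps) /\
    (forall p l, p \in P i -> h l (act (p * g0)%g x) = h l (act (p * g0)%g y)).
  move=> ux.
  have uy : 1 / 2 < u i (act g0 y).
    apply: (dec (act g0 x)); last exact: ltW.
    by move=> g1 l; rewrite -!actM//; exact: Hxy.
  pose Q v := [fset s in S i | [exists l, 0 < beta (act (e l)^-1%g (act s v))]]%fset.
  have cQ v : #|` Q v|%:R <= q i by exact: vis.
  have offQ v s l : s \in S i -> s \notin Q v -> slot act beta e l (act s v) = 0.
    move=> sS; rewrite !inE sS/= => /existsPn/(_ l) nb.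
    apply/eqP; rewrite eq_le slot_ge0// andbT leNgt; apply/negP => /slot_gt0.
    exact/negP.
  have [_ _ c3] := codeP i.
  have [|h1 h2] := c3 (act g0 x) (act g0 y) (Q (act g0 x)) (Q (act g0 y)) (cQ _) (cQ _).
    move=> s k sS sv sw.
    rewrite -(fr'_code i s k _ sS); last by lra.
    rewrite -(fr'_code i s k (act g0 y) sS); last by lra.
    have := xy (s * g0)%g k; rewrite !actM// /asm !assemble_off//.
    - by move=> l; exact: offQ.
    - by move=> l; exact: offQ.
  by split=> [s sS|p l pP]; rewrite !actM//; [exact: h1|exact: h2].
have [Zx|] := pselect (remainder act S u x); last first.
  move=> /existsNP[i /existsNP[s /not_implyP[sS /negP]]]; rewrite -ltNge => us.
  have [h1 _] := tower _ _ us.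
  by have := h1 s sS; rewrite mulgV !act1.
(* The translate g j x lies in a level p reserved for parameters. The tower below it records [h] at
   g j x, and [h] there gives every [psi k] at x. *)
have [j Ujx] := ZU _ Zx.
have [[i p]/= pP up] := UD _ _ Ujx.
have [|_ h2] := tower (p^-1 * g j)%g i; first by rewrite actM.
apply: psi_sep; apply: (h_psi j) => // l.
by have := h2 p l pP; rewrite mulVKg.
Qed.

(** The affine map t -> c + (1 - 4c) t takes [0, 1/2] onto [c, 1/2 - c] and moves points by at most
    c, leaving the margin that the perturbation needs. *)
Lemma perturb (fr : 'I_m.+1 -> X -> R) (d eps : R) :
  (forall k, continuous (fr k)) -> 0 < d -> 0 < eps ->
  (forall k x, 0 <= fr k x <= 1 / 2) ->
  exists fr' : 'I_m.+1 -> X -> R, [/\ forall k, continuous (fr' k),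
    forall k x, 0 <= fr' k x <= 1 / 2, forall k x, `|fr' k x - fr k x| <= d
    & forall x y, (forall g k, asm fr' k (act g x) = asm fr' k (act g y)) ->
        mdist x y < eps].
Proof.
move=> cfr d0 eps0 fr01; pose c := Num.min d 1 / 8.
have c0 : 0 < c by rewrite divr_gt0// lt_min d0 ltr01.
have c1 : c <= 1 / 8 by rewrite ler_pM2r ?invr_gt0// ge_min lexx orbT.
have cd : c * 8 <= d by rewrite /c divfK// ge_min lexx.
have [||fr' [cfr' fr'01 fr'_near fr'_emb]] :=
  @perturb_interior (fun k x => c + (1 - 4 * c) * fr k x) c eps _ c0 eps0.
- by move=> k; apply: contD; [exact: contC|apply: contM => //; exact: contC].
- by move=> k x; have /andP[f0 f1] := fr01 k x; apply/andP; split; nra.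
exists fr'; split => // k x.
have := fr'_near k x; have /andP[f0 f1] := fr01 k x.
by rewrite !ler_norml => /andP[? ?]; apply/andP; split; nra.
Qed.

End perturbation.

(** * Passage to the limit *)

Lemma prod_continuous (T : topologicalType) (I : Type) (K : I -> topologicalType)
    (f : T -> prod_topology K) :
  (forall i, continuous (fun x => f x i)) -> continuous f.
Proof.
move=> cf x; apply/cvg_sup => i.
by apply: (continuous_comp_initial (w := fun g : prod_topology K => g i)) => y; exact: (cf i).
Qed.

Lemma hausdorff_injective (T Y : topologicalType) (f : T -> Y) :
  injective f -> continuous f -> hausdorff_space Y -> hausdorff_space T.
Proof.
move=> injf cf hY p q pq; apply: injf; apply: hY => A B nA nB.
by have [z [Az Bz]] := pq _ _ (cf _ _ nA) (cf _ _ nB); exists (f z).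
Qed.

Lemma compact_injective_embedding (T Y : topologicalType) (f : T -> Y) :
  compact [set: T] -> hausdorff_space Y -> injective f -> continuous f ->
  topological_embedding f.
Proof.
move=> cT hY injf cf; split => // A oA; apply/open_subspaceP.
exists (~` (f @` (~` A))).
  apply: closed_openC; apply: compact_closed => //; apply: continuous_compact.
    exact: continuous_subspaceT.
  by apply: subclosed_compact cT _ => //; exact: open_closedC.
apply/seteqP; split=> y [yA [x _ xy]]; split => //; try by exists x.
- apply: contrapT => nA; apply: yA; exists x => // Ax; apply: nA.
  by exists x.
- move=> [z nAz zy]; case: yA => a Aa ay; apply: nAz.
  by rewrite (injf z a)// zy.
Qed.

Section limit.
Context (R : realType) (G : groupType) (X : metricType R) (act : G -> X -> X).
Hypothesis act_action : continuous_action act.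
Hypothesis X_compact : compact [set: X].

(** By compactness of X x X one d serves all pairs: each pair is closer than [eps] or some f k (g .)
    separates it by more than 2d, and a change of f by at most d cannot close that gap. *)
Lemma robust_embedding (K : finType) (f : K -> X -> R) (eps : R) :
  (forall k, continuous (f k)) ->
  (forall x y, (forall g k, f k (act g x) = f k (act g y)) -> mdist x y < eps) ->
  exists2 d : R, 0 < d & forall f' : K -> X -> R,
    (forall k x, `|f' k x - f k x| <= d) ->
    forall x y, (forall g k, f' k (act g x) = f' k (act g y)) -> mdist x y < eps.
Proof.
move=> cf femb.
have := (compact_near_coveringP _).1 (compact_setX X_compact X_compact) R (0^'+)
  (fun d (p : X * X) => mdist p.1 p.2 < eps \/
     exists g k, 2 * d < `|f k (act g p.1) - f k (act g p.2)|) _.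
case.
  move=> [x y] _ /=.
  have [xy|nxy] := pselect (mdist x y < eps).
    pose r := (eps - mdist x y) / 2; have r0 : 0 < r by rewrite divr_gt0// subr_gt0.
    exists (([set z | mdist x z < r] `*` [set z | mdist y z < r]), setT) => /=.
      split; last exact: filterT.
      exists ([set z | mdist x z < r], [set z | mdist y z < r]) => //=.
      by split; apply/nbhs_mdist; exists r.
    move=> [[z1 z2] d] /= [[h1 h2] _]; left.
    have t1 := metric_triangle z1 x z2; have t2 := metric_triangle x y z2.
    by rewrite (metric_sym z1 x) in t1; rewrite /r in h1 h2; lra.
  have [g [k fxy]] : exists g k, f k (act g x) <> f k (act g y).
    apply: contrapT => H; apply: nxy; apply: femb => g k.
    by apply: contrapT => ne; apply: H; exists g, k.
  pose c := `|f k (act g x) - f k (act g y)|.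
  have c0 : 0 < c by rewrite normr_gt0 subr_eq0; apply/eqP.
  have cfg := cont_act act_action (g := g) (@cf k).
  have c8 : 0 < c / 8 by rewrite divr_gt0.
  exists (([set z | `|f k (act g x) - f k (act g z)| < c / 8] `*`
           [set z | `|f k (act g y) - f k (act g z)| < c / 8]), [set d | d < c / 8]) => /=.
    split; last exact: (nbhs_right_lt c8).
    exists ([set z | `|f k (act g x) - f k (act g z)| < c / 8],
            [set z | `|f k (act g y) - f k (act g z)| < c / 8]) => //=.
    by split; have /continuousP_dist := cfg; apply.
  move=> [[z1 z2] d] /= [[h1 h2] hd]; right; exists g, k.
  rewrite ltNge; apply/negP => h3.
  have : c <= `|f k (act g x) - f k (act g z1)| + `|f k (act g z1) - f k (act g z2)| +
      `|f k (act g y) - f k (act g z2)|.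
    rewrite /c (_ : _ - _ = (f k (act g x) - f k (act g z1)) +
      (f k (act g z1) - f k (act g z2)) - (f k (act g y) - f k (act g z2))); last by lra.
    apply: le_trans (ler_normB _ _) _; rewrite lerD2r; exact: ler_normD.
  lra.
move=> d /= d0 H; exists (d / 2); first by rewrite divr_gt0.
move=> f' f'f x y xy.
have d2 : 0 < d / 2 by rewrite divr_gt0.
have db : `|0 - d / 2| < d by rewrite sub0r normrN gtr0_norm//; lra.
have [//|[g [k /= lt]]] := H (d / 2) db d2 (x, y) (conj I I).
exfalso; have := f'f k (act g x); have := f'f k (act g y).
rewrite xy ltNge in lt *; move: lt => /negP lt h1 h2; apply: lt.
rewrite (_ : _ - _ = (f' k (act g y) - f k (act g y)) -
  (f' k (act g y) - f k (act g x))); last by lra.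
by apply: le_trans (ler_normB _ _) _; lra.
Qed.

(* Baire-type iteration: each step is so small that it preserves the
   separation achieved at the earlier ones. *)
Lemma limit_embedding (m : nat) (asm : ('I_m -> X -> R) -> 'I_m -> X -> R) :
  (forall fr fr' k x, `|asm fr k x - asm fr' k x| <= `|fr k x - fr' k x|) ->
  (forall fr k, (forall k, continuous (fr k)) -> continuous (asm fr k)) ->
  (forall (fr : 'I_m -> X -> R) (d eps : R), (forall k, continuous (fr k)) ->
    0 < d -> 0 < eps -> (forall k x, 0 <= fr k x <= 1 / 2) ->
    exists fr' : 'I_m -> X -> R, [/\ forall k, continuous (fr' k),
      forall k x, 0 <= fr' k x <= 1 / 2, forall k x, `|fr' k x - fr k x| <= d
      & forall x y, (forall g k, asm fr' k (act g x) = asm fr' k (act g y)) ->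
          mdist x y < eps]) ->
  exists fr : 'I_m -> X -> R, [/\ forall k, continuous (fr k),
    forall k x, 0 <= fr k x <= 1 / 2
    & forall x y, (forall g k, asm fr k (act g x) = asm fr k (act g y)) -> x = y].
Proof.
move=> asm_lip asm_cont step.
pose good (s : ('I_m -> X -> R) * R) := [/\ forall k, continuous (s.1 k),
  forall k x, 0 <= s.1 k x <= 1 / 2 & 0 < s.2].
pose next (n : nat) (s s' : ('I_m -> X -> R) * R) :=
  [/\ forall k x, `|s'.1 k x - s.1 k x| <= s.2 / 2, s'.2 <= s.2 / 2
    & forall f, (forall k x, `|f k x - s'.1 k x| <= s'.2) ->
      forall x y, (forall g k, asm f k (act g x) = asm f k (act g y)) ->
        mdist x y < n.+1%:R^-1 :> R].
have nextE (ns : nat * {s | good s}) : exists s' : {s | good s},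
    next ns.1 (sval ns.2) (sval s').
  case: ns => n [[fr t] [/= cfr fr01 t0]].
  have t2 : 0 < t / 2 by rewrite divr_gt0.
  have n0 : 0 < n.+1%:R^-1 :> R by rewrite invr_gt0.
  have [fr' [cfr' fr'01 fr'fr emb]] := step fr (t / 2) (n.+1%:R^-1) cfr t2 n0 fr01.
  have [d d0 dP] := robust_embedding (fun k => asm_cont fr' k cfr') emb.
  have g' : good (fr', Num.min (t / 2) d).
    by split => //=; rewrite lt_min t2.
  exists (exist _ _ g'); split => //=; first by rewrite ge_min lexx.
  move=> f ff; apply: dP => k x; apply: le_trans (asm_lip _ _ _ _) _.
  by apply: le_trans (ff k x) _; rewrite ge_min lexx orbT.
have [nx nxP] := choice nextE.
have g0 : good ((fun _ _ => 0), 1).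
  by split => //= k; [exact: contC|move=> x; rewrite lexx/=; lra].
pose s := fix s n : {s | good s} := if n is n'.+1 then nx (n', s n') else exist _ _ g0.
pose fr n := (sval (s n)).1; pose t n := (sval (s n)).2.
have sP n : good (sval (s n)) by exact: (svalP (s n)).
have nP n : next n (sval (s n)) (sval (s n.+1)) by exact: (nxP (n, s n)).
have t0 n : 0 < t n by have [] := sP n.
have tS n : t n.+1 <= t n / 2 by have [] := nP n.
have frS n k x : `|fr n.+1 k x - fr n k x| <= t n / 2 by have [+ _ _] := nP n; exact.
have t_pow n : t n <= 2^-1 ^+ n.
  elim: n => [|n IH]; first by rewrite expr0.
  by apply: (le_trans (tS n)); rewrite exprS; lra.
have lim k : exists v : X -> R, continuous v /\
    forall n x, `|v x - fr n k x| <= 2 * 2^-1 ^+ n.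
  apply: (@uniform_limit R X (fun n => fr n k)).
    by move=> n; have [cn _ _] := sP n; exact: cn.
  by move=> n x; apply: le_trans (frS n k x) _; have := t_pow n; have := t0 n; lra.
have [v vP] := choice lim.
(* Step n moves the map by at most t n / 2, and t (n + 1) <= t n / 2, so all later moves together
   stay within the tolerance [t n]. *)
have tele n j k x : `|fr (n + j)%N k x - fr n k x| <= t n - t (n + j)%N.
  elim: j => [|j IH]; first by rewrite addn0 !subrr normr0 lexx.
  rewrite addnS (_ : _ - fr n k x = (fr (n + j).+1 k x - fr (n + j)%N k x) +
    (fr (n + j)%N k x - fr n k x)); last by lra.
  apply: le_trans (ler_normD _ _) _.
  by have := frS (n + j)%N k x; have := tS (n + j)%N; lra.
have vfr n k x : `|v k x - fr n k x| <= t n.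
  rewrite leNgt; apply/negP => lt.
  have e0 : 0 < `|v k x - fr n k x| - t n by rewrite subr_gt0.
  have [j jlt] := pow_half_small e0.
  have [_ /(_ (n + j)%N x) h1] := vP k.
  have h2 := tele n j k x; have h3 := t0 (n + j)%N.
  have h4 : `|v k x - fr n k x| <=
      `|v k x - fr (n + j)%N k x| + `|fr (n + j)%N k x - fr n k x|.
    by rewrite (_ : v k x - fr n k x = (v k x - fr (n + j)%N k x) +
      (fr (n + j)%N k x - fr n k x)) ?ler_normD//; lra.
  have h5 : 2 * 2^-1 ^+ (n + j) <= 2 * 2^-1 ^+ j :> R.
    by rewrite ler_pM2l// exprD ler_piMl ?exprn_ge0//; apply: exprn_ile1; lra.
  lra.
exists v; split.
- by move=> k; have [] := vP k.
- move=> k x; suff H : forall e, 0 < e -> - e <= v k x <= 1 / 2 + e.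
    by apply/andP; split; apply/ler_addgt0Pr => e /H/andP[? ?]; lra.
  move=> e e0; have [n ne] := pow_half_small e0.
  have [_ /(_ n x)] := vP k; have [_ /(_ k x)/andP[f0 f1] _] := sP n.
  rewrite ler_norml -/(fr n) in f0 f1 * => /andP[h1 h2]; apply/andP; split.
    by move: f0; rewrite -/(fr n); lra.
  by move: f1; rewrite -/(fr n); lra.
move=> x y xy; apply: (@mdist_positivity R X).
apply/eqP; rewrite eq_le mdist_ge0 andbT leNgt; apply/negP => d0.
pose n := Num.truncn (mdist x y)^-1.
have [_ _ /(_ v)] := nP n; move=> /(_ (fun k z => vfr n.+1 k z) x y xy).
apply/negP; rewrite -leNgt -[leRHS]invrK lef_pV2 ?posrE ?invr_gt0//.
by apply: ltW; rewrite truncnS_gt.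
Qed.

End limit.

(** * From the limit map to the equivariant embedding *)

Theorem theorem1 (R : realType) (G : groupType) (X : metricType R)
    (act : G -> X -> X) (M : nat)
    (G_countable : countable [set: G]) (G_infinite : infinite_set [set: G])
    (G_amenable : amenable R G)
    (X_compact : compact [set: X])
    (act_action : continuous_action act) (act_free : free_action act)
    (act_URPC : URPC R act)
    (act_mdim : mdim_lt act (M%:R / 2 : R)) :
  exists f : X -> cube_shift R M G,
    topological_embedding f /\
    (forall (h : G) (x : X), f (act h x) = left_shift h (f x)).
Proof.
have [urp cmp] := act_URPC; have [gamma' gamma'0 mdim'] := act_mdim.
(* The bound by 1 lets gamma |S| / L levels be chosen inside a shape [S]. *)
pose gamma := Num.min gamma' 1.
have gamma01 : 0 < gamma <= 1 by rewrite lt_min gamma'0 ltr01 ge_min lexx orbT.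
have mdim (U : set (set X)) : open_cover U ->
    exists (F : {fset G}) (eps : R), 0 < eps /\
    forall S : {fset G}, invariant_shape F eps S ->
    (cover_dim R (join_covers S (fun g => translate_cover act g^-1%g U)) <
     ((M%:R / 2 - gamma) * #|` S|%:R)%:E)%E.
  move=> cU; have [F [eps [eps0 H]]] := mdim' U cU; exists F, eps; split => // S inv.
  apply: lt_le_trans (H S inv) _; rewrite lee_fin ler_wpM2r// lerB//.
  by rewrite ge_min lexx.
case: M act_mdim mdim mdim' => [|m] _ mdim _.
  (* For M = 0 the dimension bound at an invariant shape, which exists by amenability, is at most 0,
     while every order is at least 0, so the strict inequality fails. *)
  exfalso; have cT : open_cover [set [set: X]].
    split; first by move=> _ ->; exact: openT.
    by rewrite bigcup_set1.
  have [F [eps [eps0 H]]] := mdim _ cT.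
  have [S [S0 inv]] := G_amenable F eps eps0.
  have /ereal_inf_lt[_ [V _ <-]] := H S inv; apply/negP; rewrite -leNgt.
  apply: (@le_trans _ _ 0%E); last by apply: ereal_sup_ubound; left.
  rewrite lee_fin mul0r sub0r mulNr oppr_le0 mulr_ge0//.
  by have /andP[/ltW] := gamma01.
have q0 : 0 < gamma / (2 * m.+1%:R).
  by have /andP[g0 _] := gamma01; rewrite divr_gt0// mulr_gt0.
have [beta [e [[cbeta beta01 e0] dbeta [c c0 cE] visits]]] :=
  slots_exist act_action X_compact act_free urp G_infinite q0.
have oE : open [set x | 1 / 2 < beta x] by exact: open_gt_cont.
have [H [cH H01 HE castles]] := decodable_castles act_action X_compact act_free
  urp cmp G_infinite G_countable oE c0 cE.
have [fr [cfr fr01 fr_emb]] := limit_embedding act_action X_compact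
  (@assemble_lip R G X act beta e H m beta01 dbeta)
  (fun fr k => @assemble_cont R G X act act_action beta e H m cbeta cH fr k)
  (perturb act_action X_compact cmp G_infinite beta01 e0 dbeta H01 HE
     castles gamma01 visits mdim).
pose f := assemble act beta e H fr.
have f01 k x : f k x \in (`[0, 1]%classic : set R).
  by rewrite inE/= in_itv/=; exact: assemble01.
pose F (x : X) : cube_shift R m.+1 G :=
  fun g k => exist (fun y => y \in (`[0, 1]%classic : set R)) (f k (act g^-1%g x)) (f01 _ _).
exists F; split; last first.
  move=> h x; apply/funext => g; apply/funext => k; apply: val_inj => /=.
  by rewrite -actM// invgM invgK.
(* A continuous injection from a compact space into a Hausdorff one; agreement of the images at all
   group elements is agreement of f along the two orbits. *)
apply: compact_injective_embedding => //.
- apply: hausdorff_product => g; apply: hausdorff_product => k.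
  apply: (@hausdorff_injective _ _ set_val) (@norm_hausdorff _ R).
    exact: val_inj.
  exact: initial_continuous.
- move=> x y xy; apply: fr_emb => g k.
  have := congr1 (fun z : cube_shift R m.+1 G => val (z g^-1%g k)) xy.
  by rewrite /= invgK.
apply: prod_continuous => g; apply: prod_continuous => k.
apply: (continuous_comp_initial (w := set_val)).
apply: (cont_act act_action (f := f k)).
exact: assemble_cont.
Qed.
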